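(* Let $\Xi>0$, $C_0>0$, $\delta_0>0$, and $r_-(t)=-\delta_0$ for $t>0$. Let $C_n\to\infty$. Then, as $n\to\infty$, uniformly over $P\in\mathcal{P}(\Xi,C_0,r_-)$, $$\hat\xi_n^2-\xi_*^2(P)=O_p(n^{-1/2}).$$
   Context: A distribution $P$ on $\mathbb{R}$ (with $X\sim P$) is sub-Gaussian if there is $\xi^2>0$ with $\mathbb{E}[e^{\lambda X}]\le e^{\lambda^2\xi^2/2}$ for all $\lambda\in\mathbb{R}$; $\xi_*^2(P)\ge 0$ denotes the smallest such number. Let $L(\lambda;P)=\frac{2}{\lambda^2}\log\mathbb{E}_P[e^{\lambda X}]$ for $\lambda\ne0$, $L(0;P)=\mathrm{Var}_P(X)$, and $\delta_P(C)=\sup_{|\lambda|\ge C}L(\lambda;P)-\sup_{|\lambda|\le C}L(\lambda;P)$. $\mathcal{P}(\Xi)$ is the set of sub-Gaussian $P$ with $\xi_*^2(P)\le\Xi$, and $\mathcal{P}(\Xi,C_0,r)$ is the set of $P\in\mathcal{P}(\Xi)$ with $\delta_P(C)\le r(C)$ for all $C\ge C_0$. Given $X_1,\dots,X_n$ i.i.d. from $P$ with sample mean $\bar X$, let $L_n(\lambda)=\frac{2}{\lambda^2}\log\bigl\{\frac1n\sum_{i=1}^n e^{\lambda(X_i-\bar X)}\bigr\}$ for $\lambda\neq 0$, $L_n(0)=\frac1n\sum_{i=1}^n(X_i-\bar X)^2$, and $\hat\xi_n^2=\sup_{|\lambda|\le C_n}L_n(\lambda)$, where $C_n>0$. ''$Y_n=O_p(a_n)$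 uniformly over $P\in\mathcal{Q}$'' means: for every $\eta>0$ there exist $K<\infty$ and $N$ such that $\sup_{P\in\mathcal{Q}}\mathbb{P}_P(|Y_n|>Ka_n)\le\eta$ for all $n\ge N$. *)

(* Defs.v *)
From HB Require Import structures.
From mathcomp Require Import all_boot all_order all_algebra.
From mathcomp Require Import all_classical all_reals all_analysis.
Set Implicit Arguments.
Unset Strict Implicit.
Unset Printing Implicit Defensive.
Import Order.TTheory GRing.Theory Num.Theory.
Import numFieldNormedType.Exports.
Local Open Scope classical_set_scope.
Local Open Scope ring_scope.

(* A distribution on the line is a Borel probability P : probability R R, and
   X ~ P is the identity of R; 'M_P idfun l is then E_P[exp(l X)] in \bar R,
   equal to +oo when exp(l X) is not integrable. *)

Definition variance_proxies (R : realType) (P : probability R R) : set R :=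
  [set s | 0 < s /\
    forall l : R, ('M_P idfun l <= (expR (l ^+ 2 * s / 2)%R)%:E)%E].

Definition sub_gaussian (R : realType) (P : probability R R) : Prop :=
  variance_proxies P !=set0.

(* For sub-Gaussian P the infimum is a minimum, except that it is 0 when P is
   the Dirac mass at 0, for which every s > 0 is a variance proxy. *)
Definition opt_proxy (R : realType) (P : probability R R) : R :=
  inf (variance_proxies P).

(* fine is harmless: both quantities are finite when P is sub-Gaussian. *)
Definition Lpop (R : realType) (P : probability R R) (l : R) : R :=
  if l == 0 then fine 'V_P[idfun] else 2 / l ^+ 2 * ln (fine ('M_P idfun l)).

(* For sub-Gaussian P the values of Lpop P lie in [0, opt_proxy P], so both
   suprema are genuine least upper bounds when 0 <= C. *)
Definition tail_gap (R : realType) (P : probability R R) (C : R) : R :=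
  sup [set Lpop P l | l in [set l : R | C <= `|l|]] -
  sup [set Lpop P l | l in [set l : R | `|l| <= C]].

Definition sub_gaussian_class (R : realType) (Xi : R) : set (probability R R) :=
  [set P | sub_gaussian P /\ opt_proxy P <= Xi].

Definition sub_gaussian_gap_class (R : realType) (Xi C0 : R) (r : R -> R) :
    set (probability R R) :=
  [set P | sub_gaussian_class Xi P /\
    forall C : R, C0 <= C -> tail_gap P C <= r C].

Definition sample_mean (R : realType) (n : nat) (x : 'I_n -> R) : R :=
  n%:R^-1 * \sum_(i < n) x i.

Definition Lemp (R : realType) (n : nat) (x : 'I_n -> R) (l : R) : R :=
  if l == 0 then n%:R^-1 * \sum_(i < n) (x i - sample_mean x) ^+ 2
  else 2 / l ^+ 2 *
       ln (n%:R^-1 * \sum_(i < n) expR (l * (x i - sample_mean x))).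

Definition proxy_estimator (R : realType) (n : nat) (C : R) (x : 'I_n -> R) : R :=
  sup [set Lemp x l | l in [set l : R | `|l| <= C]].

Definition mutually_independent d (T : measurableType d) (R : realType)
    (Pr : probability T R) (n : nat) (X : 'I_n -> {RV Pr >-> R}) : Prop :=
  forall A : 'I_n -> set R, (forall i, measurable (A i)) ->
    Pr (\bigcap_i (X i @^-1` A i)) = (\prod_(i < n) Pr (X i @^-1` A i))%E.

Definition iid_from d (T : measurableType d) (R : realType)
    (Pr : probability T R) (P : probability R R) (n : nat)
    (X : 'I_n -> {RV Pr >-> R}) : Prop :=
  (forall i (A : set R), measurable A -> distribution Pr (X i) A = P A) /\
  mutually_independent X.

(* The statistic Y P n may depend on the true distribution P. A sample of size n
   lives on an arbitrary probability space; by the i.i.d. condition the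
   probability of a measurable event in the sample depends only on P, so
   ranging over all such spaces as well as over P adds nothing to the supremum. *)
Definition Op_uniformly (R : realType) (Q : set (probability R R))
    (Y : probability R R -> forall n : nat, ('I_n -> R) -> R)
    (a : nat -> R) : Prop :=
  forall eta : R, 0 < eta -> exists (K : R) (N : nat),
    forall n : nat, (N <= n)%N ->
      (ereal_sup [set p : \bar R |
         exists P : probability R R, Q P /\
         exists (d : measure_display) (T : measurableType d)
           (Pr : probability T R) (X : 'I_n -> {RV Pr >-> R}),
           iid_from P X /\
           p = Pr [set t | (K * a n < `|Y P n (fun i => X i t)|)%R]]
       <= eta%:E)%E.

(* Main.v *)
(** Fix the sample size n and set D_k = (1/n) sum_i X_i^k - E X^k.  With
    e = K n^{-1/2}, Chebyshev and the sub-Gaussian moment bounds give, outside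
    an event of small probability, |D_k| <= e k! / (2J)^k for all k at once: the
    failure probabilities are summable in k like 4^{-k}.  Expanding the
    exponential in powers, the empirical moment generating function M_n then
    satisfies |M_n(l) - M(l) - l D_1| <= (l/J)^2 e for |l| <= J.  The linear term
    is the one removed by centering at the sample mean, so division by l^2 costs
    nothing near 0 and L_n - L = O(e) uniformly on |l| <= J.

    Beyond C_0 the gap gives M(l) <= exp(l^2 (xi2 - delta) / 2), xi2 being the
    optimal proxy.  By Markov's inequality and a union bound over the integers
    |j| >= J, M_n(j) <= exp(j^2 (xi2 - delta/2) / 2) for all of them with high
    probability, since sum_j exp(-j^2 delta / 4) is small for J large.
    Interpolating between integers, L_n <= xi2 on |l| >= J: the estimator is
    unaffected by how fast C_n grows.  The lower bound only needs one near
    maximizer of L, which the gap locates in |l| <= C_0.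

    The probability of a non-measurable set is a junk value, so the deviation
    event has to be shown measurable; this is done by restricting the supremum
    to rationals. *)

Require Import Defs.
From mathcomp Require Import all_boot all_order all_algebra.
From mathcomp Require Import all_classical all_reals all_analysis.
From mathcomp Require Import measurable_realfun ring lra.
Set Implicit Arguments.
Unset Strict Implicit.
Unset Printing Implicit Defensive.
Import Order.TTheory GRing.Theory Num.Theory.
Import numFieldNormedType.Exports.
Local Open Scope classical_set_scope.
Local Open Scope ring_scope.

(** * Exponential inequalities *)

Section expR_lemmas.
Variable R : realType.
Implicit Types x y t : R.

Lemma exprn_div_fact_le_expR x n : 0 <= x -> x ^+ n / n`!%:R <= expR x.
Proof.
move=> x0; case: n => [|n].
  by rewrite expr0 fact0 divr1 -expR0 ler_expR.
by apply: le_trans (expR_ge1Dxn n x0); rewrite lerDr.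
Qed.

Lemma expR_norm_le x : expR `|x| <= expR x + expR (- x).
Proof. by case: (ger0P x) => _; rewrite ?lerDl ?lerDr expR_ge0. Qed.

(** A single term of the series of exp(t|x|) is at most the whole sum. The scale t stays free: it is
    later taken large enough for the moment bounds to decay geometrically in k. *)
Lemma expr_even_le_expR x t k : 0 < t ->
  x ^+ k.*2 <= (k.*2)`!%:R / t ^+ k.*2 * (expR (t * x) + expR (- t * x)).
Proof.
move=> t0; have tk0 : 0 < t ^+ k.*2 by rewrite exprn_gt0.
have f0 : 0 < (k.*2)`!%:R :> R by rewrite ltr0n fact_gt0.
have -> : x ^+ k.*2 = `|x| ^+ k.*2 by rewrite -!mul2n !exprM real_normK ?num_real.
have := @exprn_div_fact_le_expR (t * `|x|) k.*2 (mulr_ge0 (ltW t0) (normr_ge0 _)).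
rewrite exprMn ler_pdivrMr // => h.
have := expR_norm_le (t * x); rewrite normrM (gtr0_norm t0) mulNr => h2.
rewrite -(ler_pM2l tk0) mulrA mulrCA divff ?gt_eqF // mulr1.
by apply: le_trans h _; rewrite mulrC ler_pM2l.
Qed.

Lemma expR_subr1_le x : 0 <= x -> expR x - 1 <= x * expR x.
Proof.
move=> x0; have := expR_ge1Dx (- x); rewrite expRN => h.
have e0 := expR_gt0 x.
have := ler_wpM2l (ltW e0) h; rewrite divff ?gt_eqF //; nra.
Qed.

(** Used with x = l times the sample mean. The third bound expresses the cancellation due to
    centering: the factor exp(-x) removes the linear term up to an error x^2. *)
Lemma expRN_bounds x : `|x| <= 2^-1 ->
  [/\ expR (- x) <= 2, `|expR (- x) - 1| <= 2 * `|x| &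
      `|expR (- x) * (1 + x) - 1| <= x ^+ 2].
Proof.
rewrite ler_norml => /andP[xl xr].
have h1 := expR_ge1Dx x; have h2 := expR_ge1Dx (- x).
have e0 := expR_gt0 x.
have hx : expR (- x) * (1 + x) <= 1.
  by rewrite expRN ler_pdivrMl ?mulr1.
have h3 : expR (- x) <= 2 by have := expR_gt0 (- x); nra.
split => //.
  by rewrite ler_norml; case: (ger0P x) => x0; apply/andP; split; nra.
rewrite ler_norml; apply/andP; split; nra.
Qed.

(* The centered empirical m.g.f. and M are both >= 1 by Jensen, so that no
   division by them is needed when taking logarithms. *)
Lemma ln_subr_le x y : 1 <= x -> 1 <= y -> `|ln x - ln y| <= `|x - y|.
Proof.
move=> x1 y1.
suff H (a b : R) : 1 <= a -> 1 <= b -> ln a - ln b <= `|a - b|.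
  by rewrite ler_norml H // andbT lerNl opprB distrC H.
move=> a1 b1; have b0 : 0 < b by lra.
have a0 : 0 < a by lra.
rewrite -ln_div ?posrE //.
have -> : a / b = 1 + (a - b) / b by field; rewrite gt_eqF.
apply: le_trans (le_ln1Dx _) _.
  by rewrite ltr_pdivlMr // mulN1r; lra.
rewrite ler_pdivrMr //; apply: le_trans (ler_norm _) _.
by rewrite ler_peMr.
Qed.

Lemma cvg_series_expR x : (\sum_(0 <= k < n) x ^+ k / k`!%:R) @[n --> \oo] --> expR x.
Proof.
exact: (is_cvg_series_exp_coeff x : series (exp_coeff x) @ \oo --> expR x).
Qed.

Lemma norm_series_expR_le x n :
  `|\sum_(0 <= k < n) x ^+ k / k`!%:R| <= expR `|x|.
Proof.
apply: le_trans (ler_norm_sum _ _ _) _.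
under eq_bigr do rewrite normrM normrX normfV (ger0_norm (ler0n _ _)).
apply: (@nondecreasing_cvgn_le R (fun n => \sum_(0 <= k < n) `|x| ^+ k / k`!%:R)).
  move=> a b ab; rewrite (big_cat_nat (leq0n _) ab) //= lerDl.
  by apply: sumr_ge0 => k _; rewrite divr_ge0 ?exprn_ge0 ?ler0n.
exact: is_cvg_series_exp_coeff.
Qed.

(** The central binomial coefficient is at most 4^k; in the induction, (2k+2)(2k+1) <= 4(k+1)^2. *)
Lemma fact_double_le k : (k.*2)`!%:R <= 4 ^+ k * (k`!%:R) ^+ 2 :> R.
Proof.
rewrite -!natrX -natrM ler_nat.
elim: k => // k IH; rewrite doubleS !factS expnS expnMn.
rewrite mulnA; apply: leq_trans (leq_mul (leqnn _) IH) _.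
have -> : (4 * 4 ^ k * (k.+1 ^ 2 * k`! ^ 2) = (4 * k.+1 ^ 2) * (4 ^ k * k`! ^ 2))%N.
  by rewrite mulnACA.
by apply: leq_mul => //; rewrite -doubleS -mulnn (_ : 4 = 2 * 2)%N // mulnACA mul2n leq_mul.
Qed.

End expR_lemmas.

(* The constant 1 in front of y^2 is what makes the variance bounded by every
   variance proxy in [moment2_le]. *)
Lemma expR_even_ge {R : realType} (y : R) : 2 + y ^+ 2 <= expR y + expR (- y).
Proof.
pose u n := \sum_(0 <= k < n) (y ^+ k / k`!%:R + (- y) ^+ k / k`!%:R).
have cu : u n @[n --> \oo] --> expR y + expR (- y).
  have -> : u = (fun n => \sum_(0 <= k < n) y ^+ k / k`!%:R +
                 \sum_(0 <= k < n) (- y) ^+ k / k`!%:R).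
    by apply/funext => n; rewrite -big_split.
  apply: cvgD; exact: cvg_series_expR.
have nd : nondecreasing_seq u.
  move=> a b ab; rewrite /u (big_cat_nat (leq0n _) ab) //= lerDl.
  apply: sumr_ge0 => k _; rewrite -mulrDl divr_ge0 ?ler0n // exprNn.
  rewrite -[(-1) ^+ k]signr_odd; have [_|ek] := boolP (odd k).
    by rewrite expr1 mulN1r subrr.
  by rewrite expr0 mul1r addr_ge0 // exprn_even_ge0.
(* The odd terms of the symmetrised series cancel and the even ones are nonnegative, so its partial
   sums increase; the one with three terms is 2 + y^2. *)
have := nondecreasing_cvgn_le nd (cvgP _ cu) 3.
rewrite (cvg_lim _ cu) // => /(le_trans _); apply.
rewrite /u !big_nat_recr //= big_geq // add0r !expr0 !expr1 sqrrN.
rewrite !(fact0, factS) !muln1 ; lra.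
Qed.

(** * Averages of an i.i.d. sample *)

Section transfer_law.
Local Open Scope ereal_scope.
Context {d d'} {X : measurableType d} {Y : measurableType d'} {R : realType}.
Variables (mu : {measure set X -> \bar R}) (nu : {measure set Y -> \bar R}).
Variable phi : X -> Y.
Hypothesis mphi : measurable_fun [set: X] phi.
Hypothesis law : forall A, measurable A -> mu (phi @^-1` A) = nu A.

(** Stated for an arbitrary measurable [phi], so that one change of variables serves both a
    coordinate X_i and a pair (X_i, X_j). *)
Lemma ge0_integral_law (f : Y -> \bar R) : measurable_fun [set: Y] f ->
  (forall y, 0 <= f y) -> \int[mu]_x f (phi x) = \int[nu]_y f y.
Proof.
move=> mf f0; rewrite -(preimage_setT phi) -(ge0_integral_pushforward mphi) //.
by apply: eq_measure_integral => A mA _; exact: law.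
Qed.

Lemma integrable_law (f : Y -> \bar R) : nu.-integrable [set: Y] f ->
  mu.-integrable [set: X] (f \o phi).
Proof.
move=> /integrableP[mf intf]; apply/integrableP; split.
  exact: measurableT_comp.
have /= -> // := @ge0_integral_law (abse \o f) (measurableT_comp (@abse_measurable R setT) mf) _.
Qed.

Lemma integral_law (f : Y -> \bar R) : nu.-integrable [set: Y] f ->
  \int[mu]_x f (phi x) = \int[nu]_y f y.
Proof.
move=> intf; have [mf _] := integrableP _ _ _ intf.
rewrite -(preimage_setT phi) -(integral_pushforward mphi) //.
  by apply: eq_measure_integral => A mA _; exact: law.
exact: integrable_law.
Qed.

End transfer_law.

Lemma markov_ge0 {d} {T : measurableType d} {R : realType}
    (Pr : probability T R) (f : T -> R) (c v : R) :
  measurable_fun setT f -> (forall t, 0 <= f t) -> 0 < c ->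
  (\int[Pr]_t (f t)%:E <= v%:E)%E -> (Pr [set t | (c <= f t)%R] <= (v / c)%:E)%E.
Proof.
move=> mf f0 c0 fv.
pose F : {RV Pr >-> R} :=
  MeasurableFun.Pack (MeasurableFun.Class (isMeasurableFun.Build _ _ _ _ _ mf)).
have := @markov _ _ _ Pr F id c c0 (@measurable_id _ _ setT) (fun r h => h)
  (fun x y _ _ h => h).
have -> : [set x | (c%:E <= `|(F x)%:E|)%E] = [set t | c <= f t].
  by apply/seteqP; split => t /=; rewrite lee_fin ger0_norm ?f0.
have -> : ('E_Pr[id \o (fun x => `|x|%R) \o F] = \int[Pr]_t (f t)%:E)%E.
  rewrite unlock; apply: eq_integral => t _ /=.
  by rewrite ger0_norm ?f0.
move=> /le_trans /(_ fv) h.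
by rewrite EFinM muleC lee_pdivlMl.
Qed.

Definition sample_avg {R : realType} (n : nat) (x : 'I_n -> R) (h : R -> R) : R :=
  n%:R^-1 * \sum_(i < n) h (x i).

Section iid_sample.
Local Open Scope ereal_scope.
Context {d} {T : measurableType d} {R : realType}.
Variables (Pr : probability T R) (P : probability R R) (n : nat).
Variable X : 'I_n -> {RV Pr >-> R}.
Hypothesis iidX : iid_from P X.

Let lawX i A : measurable A -> Pr (X i @^-1` A) = P A.
Proof. exact: iidX.1. Qed.

(** A product measure is determined by its values on rectangles. For B x D, independence is applied
    to the family equal to B at i, to D at j and to the whole line elsewhere. *)
Lemma iid_pair_law i j : i != j -> forall A, measurable A ->
  Pr ((fun t => (X i t, X j t)) @^-1` A) = (P \x P) A.
Proof.
move=> ij A mA.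
have mZ : measurable_fun setT (fun t => (X i t, X j t)).
  by apply: measurable_fun_pair.
pose Z : {mfun T >-> (R * R)%type} :=
  MeasurableFun.Pack (MeasurableFun.Class (isMeasurableFun.Build _ _ _ _ _ mZ)).
apply/esym; apply: (@product_measure_unique _ _ _ _ R P P (distribution Pr Z)) => //.
move=> B D mB mD.
have [_ indep] := iidX.
pose F k := if k == i then B else if k == j then D else setT.
have mF k : measurable (F k) by rewrite /F; case: ifP => // _; case: ifP.
have := indep F mF.
have -> : \bigcap_k (X k @^-1` F k) = Z @^-1` (B `*` D).
  apply/seteqP; split => t /=.
    move=> h; split => /=; first by have := h i I; rewrite /F eqxx.
    by have := h j I; rewrite /F eq_sym (negbTE ij) eqxx.
  by move=> [/= hB hD] k _ /=; rewrite /F; case: eqP => [->//|_]; case: eqP => [->|].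
rewrite (bigD1 i) //= (bigD1 j) 1?eq_sym //= big1 => [|k /andP[ki kj]].
  by rewrite {1 2}/F eqxx eq_sym (negbTE ij) eqxx !lawX // mule1.
by rewrite /F (negbTE ki) (negbTE kj) preimage_setT probability_setT.
Qed.


Lemma iid_expectation (h : R -> R) i : P.-integrable setT (EFin \o h) ->
  Pr.-integrable setT (EFin \o (h \o X i)) /\
  \int[Pr]_t (h (X i t))%:E = \int[P]_x (h x)%:E.
Proof.
have mX : measurable_fun setT (X i) by [].
move=> ih; split; first exact: (integrable_law mX (lawX i) ih).
exact: (integral_law mX (lawX i) ih).
Qed.

Lemma ge0_iid_expectation (h : R -> R) i : measurable_fun setT h ->
  (forall x, (0 <= h x)%R) ->
  \int[Pr]_t (h (X i t))%:E = \int[P]_x (h x)%:E.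
Proof.
have mX : measurable_fun setT (X i) by [].
move=> mh h0; apply: (ge0_integral_law mX (lawX i) (f := EFin \o h)) => //.
exact/measurable_EFinP.
Qed.

Lemma iid_expectationM (h : R -> R) i j : i != j ->
  P.-integrable setT (EFin \o h) ->
  Pr.-integrable setT (fun t => (h (X i t) * h (X j t))%:E) /\
  \int[Pr]_t (h (X i t) * h (X j t))%:E =
  (\int[P]_x (h x)%:E) * (\int[P]_x (h x)%:E).
Proof.
move=> ij ih.
have mZ : measurable_fun setT (fun t => (X i t, X j t)).
  by apply: measurable_fun_pair.
pose f (z : R * R) := (h z.1 * h z.2)%:E.
have mh : measurable_fun setT h.
  by have [/measurable_EFinP] := integrableP _ _ _ ih.
have mf : measurable_fun setT f.
  apply/measurable_EFinP; apply: measurable_funM; apply: measurableT_comp => //.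
have fin : \int[P]_x (h x)%:E \is a fin_num.
  exact: (integrable_fin_num measurableT ih).
have ifn : (P \x P).-integrable setT f.
  apply/(integrable12ltyP P P mf).
  under eq_integral => x _.
    under eq_integral do rewrite /f /= normrM EFinM.
    rewrite ge0_integralZl_EFin //; last first.
      by apply/measurable_EFinP; apply: measurableT_comp.
    over.
  have iabs := integrable_abse ih.
  have fabs : \int[P]_x `|(h x)%:E| \is a fin_num.
    exact: (integrable_fin_num measurableT iabs).
  rewrite /=; under eq_integral do rewrite /=.
  rewrite -(fineK fabs) ge0_integralZr //; last 2 first.
  - by apply/measurable_EFinP; apply: measurableT_comp.
  - by rewrite lee_fin fine_ge0 // integral_ge0.
  by rewrite lte_mul_pinfty // ?integral_ge0 // ltry.
split.
  exact: (integrable_law mZ (iid_pair_law ij) ifn).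
rewrite (integral_law mZ (iid_pair_law ij) ifn) -integral12_prod_meas1 //.
rewrite /fubini_F; under eq_integral => x _.
  under eq_integral do rewrite /f /= EFinM.
  rewrite integralZl //; over.
by rewrite -{1}(fineK fin) integralZr // fineK.
Qed.

(** After expanding the square, the off-diagonal terms factor by independence and vanish because h
    is centered; the n diagonal terms remain. *)
Lemma iid_sum_sqr (h : R -> R) :
  P.-integrable setT (EFin \o h) ->
  P.-integrable setT (fun x => (h x ^+ 2)%:E) ->
  \int[P]_x (h x)%:E = 0 ->
  \int[Pr]_t ((\sum_(i < n) h (X i t)) ^+ 2)%:E
  = n%:R%:E * \int[P]_x (h x ^+ 2)%:E.
Proof.
move=> ih ih2 h0.
have mh : measurable_fun setT h.
  by have [/measurable_EFinP] := integrableP _ _ _ ih.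
have iM i j : Pr.-integrable setT (fun t => (h (X i t) * h (X j t))%:E).
  have [->|ij] := eqVneq i j; last by have [] := iid_expectationM ij ih.
  have [+ _] := iid_expectation j ih2.
  by apply: eq_integrable => // t _ /=; rewrite expr2.
transitivity (\int[Pr]_t \sum_(i < n) \sum_(j < n) (h (X i t) * h (X j t))%:E).
  apply: eq_integral => t _; rewrite expr2 big_distrlr /= -sumEFin.
  by apply: eq_bigr => i _; rewrite -sumEFin.
rewrite integral_sum //; last by move=> i; apply: integrable_sum.
under eq_bigr do rewrite integral_sum //.
transitivity (\sum_(i < n) \int[P]_x (h x ^+ 2)%:E); last first.
  rewrite -(fineK (integrable_fin_num measurableT ih2)) sumEFin sumr_const card_ord.
  by rewrite -[in LHS]mulr_natl EFinM.
apply: eq_bigr => i _; rewrite (bigD1 i) //= big1 => [|j ji].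
  have [_ <-] := iid_expectation i ih2.
  by rewrite adde0; apply: eq_integral => t _; rewrite expr2.
by rewrite eq_sym in ji; have [_ ->] := iid_expectationM ji ih; rewrite h0 mule0.
Qed.

Lemma measurable_sample_avg (h : R -> R) : measurable_fun setT h ->
  measurable_fun setT (fun t => sample_avg (X ^~ t) h).
Proof.
move=> mh; apply: measurable_funM => //; apply: measurable_sum => i.
exact: measurableT_comp.
Qed.

Lemma sample_avg_chebyshev (h : R -> R) (e v : R) : (0 < n)%N -> (0 < e)%R ->
  measurable_fun setT h -> \int[P]_x (h x ^+ 2)%:E <= v%:E ->
  Pr [set t | (e <= `|sample_avg (X ^~ t) h - Rintegral P setT h|)%R]
  <= (v / (n%:R * e ^+ 2))%:E.
Proof.
move=> n0 e0 mh hv; have n0R : (0 < n%:R :> R)%R by rewrite ltr0n.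
have ih2 : P.-integrable setT (fun x => (h x ^+ 2)%:E).
  apply/integrableP; split; first by apply/measurable_EFinP; apply: measurable_funX.
  under eq_integral do rewrite /= ger0_norm ?sqr_ge0 //.
  by apply: le_lt_trans hv _; rewrite ltry.
have ic (c : R) : P.-integrable setT (fun _ => c%:E).
  by apply: finite_measure_integrable_cst.
have ih : P.-integrable setT (EFin \o h).
  (* Integrability of h follows from |h| <= 1 + h^2. *)
  apply: (@le_integrable _ _ _ P setT measurableT _ (fun x => (1 + h x ^+ 2)%:E)).
  - exact/measurable_EFinP.
  - move=> x _ /=; rewrite lee_fin; apply: le_trans (ler_norm _).
    have := sqr_ge0 (`|h x| - 1)%R; rewrite -[(h x ^+ 2)%R]real_normK ?num_real //.
    have := normr_ge0 (h x); nra.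
  - by have := integrableD measurableT (ic 1%R) ih2; apply: eq_integrable.
set m := Rintegral P setT h.
have hm : \int[P]_x (h x)%:E = m%:E.
  by rewrite /m /Rintegral fineK // (integrable_fin_num measurableT ih).
pose g x := (h x - m)%R.
have ig : P.-integrable setT (EFin \o g).
  by have := integrableB measurableT ih (ic m); apply: eq_integrable.
have g0 : \int[P]_x (g x)%:E = 0.
  rewrite -[LHS]/(\int[P]_x ((EFin \o h) \- (fun=> m%:E)) x).
  rewrite (integralB measurableT ih (ic m)).
  by rewrite integral_cst //= probability_setT mule1 hm subee.
have i2mh : P.-integrable setT (fun x => ((2 * m)%:E * (h x)%:E)).
  exact: integrableZl.
have sqrE x : ((g x ^+ 2)%:E = ((h x ^+ 2)%:E - (2 * m)%:E * (h x)%:E) + (m ^+ 2)%:E)%E.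
  by rewrite -EFinM -EFinB -EFinD; congr _%:E; rewrite /g; ring.
have ih2m : P.-integrable setT (fun x => (h x ^+ 2)%:E - (2 * m)%:E * (h x)%:E).
  exact: integrableB.
have ig2 : P.-integrable setT (fun x => (g x ^+ 2)%:E).
  have := integrableD measurableT ih2m (ic (m ^+ 2)%R).
  by apply: eq_integrable => // x _; rewrite sqrE.
(* E(h - m)^2 = E h^2 - m^2, so a bound on the raw second moment also bounds the variance. *)
have g2v : \int[P]_x (g x ^+ 2)%:E <= v%:E.
  under eq_integral do rewrite sqrE.
  rewrite integralD //; rewrite integralB // integralZl // hm.
  rewrite integral_cst //= probability_setT mule1.
  rewrite -addeA; apply: le_trans hv; rewrite -EFinD.
  rewrite -[leRHS]adde0 leeD // lee_fin; have := sqr_ge0 m; nra.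
(* The event is put in squared form, with the centered sum equal to n times the deviation, so that
   Markov applies to the square. *)
have -> : [set t | (e <= `|sample_avg (X ^~ t) h - m|)%R] =
    [set t | ((n%:R * e) ^+ 2 <= (\sum_(i < n) g (X i t)) ^+ 2)%R].
  apply/seteqP; split => t /=;
    rewrite -[((\sum_(i < n) g (X i t)) ^+ 2)%R]real_normK ?num_real //
      ler_sqr ?nnegrE ?mulr_ge0 ?ler0n ?(ltW e0) //;
    have -> : (\sum_(i < n) g (X i t) = n%:R * (sample_avg (X ^~ t) h - m))%R by
      rewrite sumrB sumr_const card_ord /sample_avg mulrBr mulrA divff ?gt_eqF //
        mul1r mulr_natl.
  - by rewrite normrM ger0_norm // ler_pM2l.
  - by rewrite normrM ger0_norm // ler_pM2l.
have -> : (v / (n%:R * e ^+ 2) = (n%:R * v) / (n%:R * e) ^+ 2)%R.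
  by field; rewrite !gt_eqF.
apply: (@markov_ge0 _ _ _ Pr (fun t => (\sum_(i < n) g (X i t)) ^+ 2)%R).
- apply: measurable_funX; apply: measurable_sum => i.
  by apply: measurable_funB => //; apply: measurableT_comp.
- by move=> t; apply: sqr_ge0.
- by rewrite exprn_gt0 // mulr_gt0.
by rewrite iid_sum_sqr // EFinM lee_pmul2l.
Qed.

Lemma sample_avg_markov (h : R -> R) (c v : R) : (0 < n)%N -> (0 < c)%R ->
  measurable_fun setT h -> (forall x, (0 <= h x)%R) ->
  \int[P]_x (h x)%:E <= v%:E ->
  Pr [set t | (c <= sample_avg (X ^~ t) h)%R] <= (v / c)%:E.
Proof.
move=> n0 c0 mh h0 hv; have n0R : (0 < n%:R :> R)%R by rewrite ltr0n.
apply: markov_ge0 => //; first exact: measurable_sample_avg.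
  by move=> t; rewrite mulr_ge0 ?invr_ge0 ?ler0n // sumr_ge0.
rewrite /sample_avg.
under eq_integral do rewrite EFinM -sumEFin.
have mhX i : measurable_fun setT (fun t => (h (X i t))%:E).
  by apply/measurable_EFinP; apply: measurableT_comp.
rewrite ge0_integralZl_EFin ?invr_ge0 ?ler0n //; last 2 first.
  by move=> t _; apply: sume_ge0 => i _; rewrite lee_fin.
  by apply: emeasurable_sum.
rewrite ge0_integral_sum //; last by move=> i t _; rewrite lee_fin.
under eq_bigr do rewrite ge0_iid_expectation //.
rewrite lee_pdivrMl //.
apply: (@le_trans _ _ (\sum_(i < n) v%:E)); first exact: lee_sum.
by rewrite sumEFin sumr_const card_ord -[in leLHS]mulr_natl EFinM.
Qed.

End iid_sample.

(** * Sub-Gaussian laws *)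

Definition mgf {R : realType} (P : probability R R) (l : R) : R :=
  \int[P]_x expR (l * x).

Definition moment {R : realType} (P : probability R R) (k : nat) : R :=
  \int[P]_x x ^+ k.

(* A variance proxy allowed to be 0, so that it includes [opt_proxy P] also when
   P is the Dirac mass at 0. *)
Definition sub_gaussian_with {R : realType} (P : probability R R) (s : R) : Prop :=
  forall l : R, (\int[P]_x (expR (l * x))%:E <= (expR (l ^+ 2 * s / 2))%:E)%E.

Lemma mmt_gen_funE {R : realType} (P : probability R R) (l : R) :
  ('M_P idfun l = \int[P]_x (expR (l * x))%:E)%E.
Proof.
by rewrite /mmt_gen_fun unlock; apply: eq_integral => x _ /=; rewrite mulrC.
Qed.

Section population.
Context {R : realType}.
Variables (P : probability R R) (s : R).
Hypothesis hs : sub_gaussian_with P s.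
Implicit Types l t x : R.

Lemma integrable_expR l : P.-integrable setT (fun x => (expR (l * x))%:E).
Proof.
apply/integrableP; split.
  by apply/measurable_EFinP; apply: measurableT_comp => //; apply: measurable_funM.
under eq_integral do rewrite /= ger0_norm ?expR_ge0 //.
by apply: le_lt_trans (hs l) _; rewrite ltry.
Qed.

Lemma integrable_expR_sym t :
  P.-integrable setT (fun x => (expR (t * x) + expR (- t * x))%:E).
Proof.
by have := integrableD measurableT (integrable_expR t) (integrable_expR (- t));
  apply: eq_integrable.
Qed.

Lemma mgfE l : (\int[P]_x (expR (l * x))%:E = (mgf P l)%:E)%E.
Proof.
by rewrite /mgf /Rintegral fineK // (integrable_fin_num measurableT (integrable_expR l)).
Qed.

Lemma mgf_le l : mgf P l <= expR (l ^+ 2 * s / 2).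
Proof. by rewrite -lee_fin -mgfE. Qed.

Lemma integrable_exprn k : P.-integrable setT (fun x => (x ^+ k)%:E).
Proof.
apply: (@le_integrable _ _ _ P setT measurableT _
  (fun x => (k`!%:R)%:E * (expR (1 * x) + expR (- 1 * x))%:E)%E).
- by apply/measurable_EFinP; apply: measurable_funX.
- move=> x _ /=; rewrite lee_fin normrX normrM (ger0_norm (ler0n _ _)).
  rewrite (ger0_norm (addr_ge0 (expR_ge0 _) (expR_ge0 _))) mul1r mulN1r.
  rewrite mulrC -ler_pdivrMr ?ltr0n ?fact_gt0 //.
  by apply: le_trans (expR_norm_le x); apply: exprn_div_fact_le_expR.
- by apply: integrableZl => //; apply: integrable_expR_sym.
Qed.

Lemma momentE k : (\int[P]_x (x ^+ k)%:E = (moment P k)%:E)%E.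
Proof.
by rewrite /moment /Rintegral fineK // (integrable_fin_num measurableT (integrable_exprn k)).
Qed.

(** This is the second moment of x^k that Chebyshev requires. The factor 2 accounts for the two
    exponentials at t and -t. *)
Lemma even_moment_le k t : 0 < t ->
  (\int[P]_x ((x ^+ k) ^+ 2)%:E <=
   ((k.*2)`!%:R / t ^+ k.*2 * (2 * expR (t ^+ 2 * s / 2)))%:E)%E.
Proof.
move=> t0; set c := _ / _.
have c0 : 0 <= c by rewrite divr_ge0 ?ler0n // exprn_ge0 // ltW.
have h : (\int[P]_x (expR (t * x) + expR (- t * x))%:E <=
    (2 * expR (t ^+ 2 * s / 2))%:E)%E.
  rewrite [leLHS](_ : _ = \int[P]_x ((expR (t * x))%:E + (expR (- t * x))%:E))%E //.
  rewrite (integralD measurableT (integrable_expR t) (integrable_expR (- t))) !mgfE.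
  have := mgf_le t; have := mgf_le (- t); rewrite sqrrN -EFinD lee_fin; lra.
apply: (@le_trans _ _ (c%:E * \int[P]_x (expR (t * x) + expR (- t * x))%:E)%E).
  rewrite -(integralZl measurableT (integrable_expR_sym t)).
  apply: ge0_le_integral => //.
  - by move=> x _; rewrite lee_fin sqr_ge0.
  - by apply/measurable_EFinP; do 2!apply: measurable_funX.
  - by have /integrableP[] := integrableZl measurableT c (integrable_expR_sym t).
  - move=> x _; rewrite -EFinM lee_fin -exprM muln2; exact: expr_even_le_expR.
by rewrite [leRHS]EFinM lee_wpmul2l ?lee_fin.
Qed.

(** Dominated convergence: every partial sum of the exponential series at lx is bounded by exp(lx) +
    exp(-lx), which is integrable. *)
Lemma cvg_moment_series l :
  \sum_(0 <= k < n) l ^+ k / k`!%:R * moment P k @[n --> \oo] --> mgf P l.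
Proof.
pose f n (x : R) := (\sum_(0 <= k < n) (l * x) ^+ k / k`!%:R)%:E.
have mf n : measurable_fun setT (f n).
  apply/measurable_EFinP; apply: measurable_sum => k.
  by apply: measurable_funM => //; apply: measurable_funX; apply: measurable_funM.
have mexp : measurable_fun setT (fun x => (expR (l * x))%:E).
  by have /integrableP[] := integrable_expR l.
have fexp : {ae P, forall x, setT x -> f ^~ x @ \oo --> (expR (l * x))%:E}.
  by apply: aeW => x _; apply: cvg_EFin; [exact: nearW|exact: cvg_series_expR].
have fdom : {ae P, forall x n, setT x ->
    (`|f n x| <= (expR (l * x) + expR (- l * x))%:E)%E}.
  apply: aeW => x n _; rewrite lee_fin mulNr.
  exact: le_trans (norm_series_expR_le _ _) (expR_norm_le _).
have [_ _] := dominated_convergence measurableT mf mexp fexp (integrable_expR_sym l) fdom.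
rewrite mgfE => h.
have fE n : (\int[P]_x f n x = (\sum_(0 <= k < n) l ^+ k / k`!%:R * moment P k)%:E)%E.
  rewrite -sumEFin.
  transitivity (\int[P]_x \sum_(0 <= k < n) ((l ^+ k / k`!%:R)%:E * (x ^+ k)%:E))%E.
    apply: eq_integral => x _; rewrite /f -sumEFin; apply: eq_bigr => k _.
    by rewrite -EFinM exprMn mulrAC.
  rewrite integral_sum //; last by move=> k; apply: integrableZl => //; apply: integrable_exprn.
  by apply: eq_bigr => k _; rewrite integralZl ?momentE //; exact: integrable_exprn.
move: h; under eq_fun do rewrite fE.
by move=> /fine_cvg.
Qed.


Lemma moment0 : moment P 0 = 1.
Proof.
apply: EFin_inj; rewrite -momentE; under eq_integral do rewrite expr0.
by rewrite integral_cst //= probability_setT mule1.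
Qed.

Lemma mgf_ge1Dx l : 1 + l * moment P 1 <= mgf P l.
Proof.
rewrite -lee_fin -mgfE EFinD EFinM -momentE.
have i1 := integrable_exprn 1.
rewrite -(integralZl measurableT i1) -[X in (X%:E + _)%E]mul1r.
have ic : P.-integrable setT (fun _ => 1%:E).
  by apply: finite_measure_integrable_cst.
have <- : (\int[P]_x 1%:E = (1 * 1)%:E)%E.
  by rewrite integral_cst //= probability_setT mule1 mulr1.
have il := integrableZl measurableT l i1.
rewrite -(integralD measurableT ic il).
apply: le_integral => //; [exact: integrableD|exact: integrable_expR|].
by move=> x _; rewrite -EFinM -EFinD lee_fin expr1 expR_ge1Dx.
Qed.

(* Otherwise 1 + l m <= exp (l^2 s / 2) fails at l = r m for small r > 0. *)
Lemma moment1 : 0 <= s -> moment P 1 = 0.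
Proof.
move=> s0; set m := moment P 1; apply/eqP; apply: contraT => m0.
have m2 : 0 < m ^+ 2 by rewrite exprn_even_gt0.
(* With r = 1/D both r s < 1 and r m^2 <= 1, so the exponent u at l = r m is at most 1/2. The bounds
   then give r m^2 <= (r m^2)(r s), which is absurd. *)
pose D := 1 + s + m ^+ 2; have D0 : 0 < D by rewrite /D; lra.
pose r := D^-1; have r0 : 0 < r by rewrite invr_gt0.
have rD : r * D = 1 by rewrite mulVf ?gt_eqF.
have rs : r * s < 1 by rewrite /D in rD; nra.
have rs0 : 0 <= r * s by rewrite mulr_ge0 // ltW.
have rm : r * m ^+ 2 <= 1 by rewrite /D in rD; nra.
have h := le_trans (mgf_ge1Dx (r * m)) (mgf_le (r * m)).
rewrite -/m in h; set u := (r * m) ^+ 2 * s / 2 in h.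
have uE : u = (r * m ^+ 2) * (r * s) / 2 by rewrite /u; ring.
have u0 : 0 <= u.
  by rewrite uE divr_ge0 // mulr_ge0 // mulr_ge0 ?sqr_ge0 // ltW.
have u1 : u <= 2^-1 by rewrite uE; nra.
have e2 : expR u <= 2.
  have [] := @expRN_bounds R (- u) _; last by rewrite opprK.
  by rewrite normrN ger0_norm.
have h2 := expR_subr1_le u0.
have h3 : r * m ^+ 2 <= u * 2.
  have -> : r * m ^+ 2 = (r * m) * m by ring.
  have : u * expR u <= u * 2 by rewrite ler_wpM2l.
  lra.
rewrite uE in h3; have : 0 < r * m ^+ 2 by rewrite mulr_gt0.
nra.
Qed.

Lemma mgf_ge1 l : 0 <= s -> 1 <= mgf P l.
Proof. by move=> s0; have := mgf_ge1Dx l; rewrite moment1 // mulr0 addr0. Qed.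

Lemma moment2_ge0 : 0 <= moment P 2.
Proof. by apply: Rintegral_ge0 => x _; rewrite sqr_ge0. Qed.

(** Adding the bounds at l and -l cancels the linear term: 2 + l^2 m <= 2 exp(l^2 s / 2), whence m
    <= s exp(l^2 s / 2) for l nonzero. The claim is the limit l -> 0, carried out below with an
    explicit l^2 = e. *)
Lemma moment2_le : 0 <= s -> moment P 2 <= s.
Proof.
move=> s0; set m := moment P 2.
have m0 : 0 <= m := moment2_ge0.
have key l : l ^+ 2 * m <= l ^+ 2 * s * expR (l ^+ 2 * s / 2).
  have h : 2 + l ^+ 2 * m <= mgf P l + mgf P (- l).
    rewrite -lee_fin (EFinD 2) (EFinD (mgf P l)) (EFinM _ m) -momentE -!mgfE.
    have i2 := integrable_exprn 2.
    have ic : P.-integrable setT (fun _ => 2%:E).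
      by apply: finite_measure_integrable_cst.
    have i2l := integrableZl measurableT (l ^+ 2) i2.
    have <- : (\int[P]_x 2%:E = 2%:E)%E.
      by rewrite integral_cst //= probability_setT mule1.
    rewrite -(integralZl measurableT i2) -(integralD measurableT ic i2l).
    rewrite -(integralD measurableT (integrable_expR l) (integrable_expR (- l))).
    apply: le_integral => //.
    - exact: integrableD.
    - by apply: integrableD => //; exact: integrable_expR.
    move=> x _; rewrite -EFinM -!EFinD lee_fin -exprMn mulNr; exact: expR_even_ge.
  have u0 : 0 <= l ^+ 2 * s / 2 by rewrite divr_ge0 // mulr_ge0 // sqr_ge0.
  have := expR_subr1_le u0.
  have := mgf_le l; have := mgf_le (- l); rewrite sqrrN; lra.
have key2 e : 0 < e -> m * (1 - e * s / 2) <= s.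
  move=> e0; have := key (Num.sqrt e); rewrite (sqr_sqrtr (ltW e0)).
  rewrite -mulrA ler_pM2l // => h.
  have := expR_ge1Dx (- (e * s / 2)); rewrite expRN => h2.
  apply: (@le_trans _ _ (m * (expR (e * s / 2))^-1)); first by rewrite ler_wpM2l.
  by rewrite ler_pdivrMr ?expR_gt0.
rewrite leNgt; apply/negP => sm.
(* If m > s, then e = (m - s)/D satisfies e m s < m - s, whereas [key2] requires m - s <= e m s /
   2. *)
pose D := 1 + m * s; have D0 : 0 < D by rewrite /D; have := mulr_ge0 m0 s0; lra.
have e0 : 0 < (m - s) / D by rewrite divr_gt0 // subr_gt0.
have := key2 _ e0.
have eD : (m - s) / D * D = m - s by rewrite divfK ?gt_eqF.
rewrite /D in eD; set e := (m - s) / _ in e0 eD *; nra.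
Qed.

Lemma variance_moment2 : 0 <= s -> fine 'V_P[idfun] = moment P 2.
Proof.
move=> s0; rewrite /variance unlock.
have -> : fine ('E_P[idfun])%E = 0.
  by rewrite -(moment1 s0) /moment /Rintegral unlock; congr fine; apply: eq_integral.
rewrite /moment /Rintegral unlock; congr fine; apply: eq_integral => x _.
by transitivity (((x - 0) * (x - 0))%:E) => //; rewrite subr0 expr2.
Qed.

End population.

(** * The optimal proxy and the gap condition *)

Section optimal_proxy.
Context {R : realType}.
Variable P : probability R R.
Hypothesis sgP : sub_gaussian P.

Lemma opt_proxy_ge0 : 0 <= opt_proxy P.
Proof. by apply: lb_le_inf => // s [/ltW]. Qed.

Lemma opt_proxy_le_proxy s : variance_proxies P s -> opt_proxy P <= s.
Proof. by apply: ge_inf; exists 0 => y [/ltW]. Qed.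

(** For fixed l the proxy condition is, after taking logarithms, a linear inequality in s, so it
    passes to the infimum. The point l = 0 is treated apart because of the division by l^2. *)
Lemma sub_gaussian_opt_proxy : sub_gaussian_with P (opt_proxy P).
Proof.
have hi : has_inf (variance_proxies P) by split => //; exists 0 => y [/ltW].
have [s0 hs0] := sgP.
have hP s : variance_proxies P s -> sub_gaussian_with P s.
  by move=> [_ h] l; rewrite -mmt_gen_funE.
move=> l; rewrite (mgfE (hP _ hs0)) lee_fin.
have M0 : 0 < mgf P l by apply: lt_le_trans ltr01 (mgf_ge1 (hP _ hs0) l (ltW hs0.1)).
rewrite -ler_ln ?posrE ?expR_gt0 // expRK.
have [->|l0] := eqVneq l 0.
  rewrite expr0n !mul0r; have := mgf_le (hP _ hs0) 0.
  by rewrite expr0n !mul0r expR0; exact: ln_le0.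
have l2 : 0 < l ^+ 2 by rewrite exprn_even_gt0.
rewrite -mulrA -ler_pdivrMl // ler_pdivlMr //; apply/ler_addgt0Pl => e e0.
have [s sP hse] := inf_adherent e0 hi.
rewrite -ler_pdivlMr // ler_pdivrMl //.
have := mgf_le (hP _ sP) l; rewrite -ler_ln ?posrE ?expR_gt0 // expRK => /le_trans; apply.
rewrite -mulrA ler_pM2l // ler_pM2r ?invr_gt0 //.
by rewrite addrC ltW.
Qed.

Lemma Lpop0 : Lpop P 0 = moment P 2.
Proof.
by rewrite /Lpop eqxx (variance_moment2 sub_gaussian_opt_proxy opt_proxy_ge0).
Qed.

Lemma LpopE l : l != 0 -> Lpop P l = 2 / l ^+ 2 * ln (mgf P l).
Proof. by move=> l0; rewrite /Lpop (negbTE l0) mmt_gen_funE. Qed.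

Lemma Lpop_le l a : l != 0 -> (Lpop P l <= a) = (mgf P l <= expR (l ^+ 2 * a / 2)).
Proof.
move=> l0; rewrite LpopE //.
have M0 : 0 < mgf P l.
  exact: lt_le_trans ltr01 (mgf_ge1 sub_gaussian_opt_proxy l opt_proxy_ge0).
rewrite -[RHS]ler_ln ?posrE ?expR_gt0 // expRK.
have l2 : 0 < l ^+ 2 by rewrite exprn_even_gt0.
by rewrite -invf_div ler_pdivrMl ?divr_gt0 // mulrAC.
Qed.

Lemma Lpop_ge0 l : 0 <= Lpop P l.
Proof.
have [->|l0] := eqVneq l 0; first by rewrite Lpop0 moment2_ge0.
rewrite LpopE // mulr_ge0 ?divr_ge0 ?sqr_ge0 //.
exact: ln_ge0 (mgf_ge1 sub_gaussian_opt_proxy l opt_proxy_ge0).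
Qed.

Lemma Lpop_le_opt l : Lpop P l <= opt_proxy P.
Proof.
have [->|l0] := eqVneq l 0.
  by rewrite Lpop0 (moment2_le sub_gaussian_opt_proxy opt_proxy_ge0).
by rewrite Lpop_le // (mgf_le sub_gaussian_opt_proxy).
Qed.

Section gap.
Variables (C0 delta : R).
Hypotheses (C00 : 0 < C0) (delta0 : 0 < delta).
Hypothesis gapP : tail_gap P C0 <= - delta.

Let tl := [set Lpop P l | l in [set l : R | C0 <= `|l|]].
Let hd := [set Lpop P l | l in [set l : R | `|l| <= C0]].

Let tl_sup : has_sup tl.
Proof.
split; first by exists (Lpop P C0); exists C0 => //=; rewrite ger0_norm // ltW.
by exists (opt_proxy P) => _ [l _ <-]; exact: Lpop_le_opt.
Qed.

Let hd_sup : has_sup hd.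
Proof.
split; first by exists (Lpop P C0); exists C0 => //=; rewrite ger0_norm // ltW.
by exists (opt_proxy P) => _ [l _ <-]; exact: Lpop_le_opt.
Qed.

Let gap : sup tl + delta <= sup hd.
Proof. have h : sup tl - sup hd <= - delta := gapP; lra. Qed.

Let tl_ge0 : 0 <= sup tl.
Proof.
apply: le_trans (Lpop_ge0 C0) _; apply: sup_upper_bound => //.
by exists C0 => //=; rewrite ger0_norm // ltW.
Qed.

(** The supremum over |l| <= C0 is itself a variance proxy: it bounds L there by definition and
    beyond C0 by the gap. It is positive because it exceeds the nonnegative tail supremum by at
    least [delta]. *)
Lemma opt_proxy_sup_head : sup hd = opt_proxy P.
Proof.
have le1 : sup hd <= opt_proxy P.
  by apply: ge_sup; [exact: hd_sup.1|move=> _ [l _ <-]; exact: Lpop_le_opt].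
apply/eqP; rewrite eq_le le1 /=; apply: opt_proxy_le_proxy; split.
  exact: lt_le_trans (ltr_wpDl tl_ge0 delta0) gap.
move=> l; rewrite mmt_gen_funE (mgfE sub_gaussian_opt_proxy) lee_fin.
have [->|l0] := eqVneq l 0.
  have := mgf_le sub_gaussian_opt_proxy 0; by rewrite expr0n !mul0r.
rewrite -Lpop_le //; case: (lerP `|l| C0) => lC.
  by apply: sup_upper_bound => //; exists l.
apply: (@le_trans _ _ (sup tl)); last by apply: le_trans gap; rewrite lerDl ltW.
by apply: sup_upper_bound => //; exists l => //=; exact: ltW.
Qed.

Lemma gap_le_opt_proxy : delta <= opt_proxy P.
Proof. by rewrite -opt_proxy_sup_head; apply: le_trans gap; rewrite lerDr tl_ge0. Qed.

Lemma mgf_le_gap l : C0 <= `|l| -> mgf P l <= expR (l ^+ 2 * (opt_proxy P - delta) / 2).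
Proof.
move=> lC; have l0 : l != 0 by rewrite -normr_gt0; exact: lt_le_trans lC.
rewrite -Lpop_le //; apply: (@le_trans _ _ (sup tl)).
  by apply: sup_upper_bound => //; exists l.
by rewrite -opt_proxy_sup_head lerBrDr gap.
Qed.

Lemma near_opt_proxy e : 0 < e -> exists2 l, `|l| <= C0 & opt_proxy P - e < Lpop P l.
Proof.
move=> e0; have [_ [l lC <-] h] := sup_adherent e0 hd_sup.
by exists l => //; rewrite -opt_proxy_sup_head.
Qed.

End gap.

End optimal_proxy.

(** * Deterministic bounds on the estimator *)

Section sample_functions.
Context {R : realType}.
Implicit Types (l : R) (h g : R -> R).
Variables (n : nat) (x : 'I_n -> R).
Hypothesis n0 : (0 < n)%N.

Definition emp_mgf l : R := sample_avg x (fun y => expR (l * y)).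

Let n0R : 0 < n%:R :> R.
Proof. by rewrite ltr0n. Qed.

Lemma sample_avg_cst (c : R) : sample_avg x (fun=> c) = c.
Proof. by rewrite /sample_avg sumr_const card_ord -[X in _ * X]mulr_natl mulKf ?gt_eqF. Qed.

Lemma sample_avgD h g : sample_avg x (fun y => h y + g y) = sample_avg x h + sample_avg x g.
Proof. by rewrite /sample_avg big_split mulrDr. Qed.

Lemma sample_avgZ (c : R) h : sample_avg x (fun y => c * h y) = c * sample_avg x h.
Proof. by rewrite /sample_avg -mulr_sumr mulrCA. Qed.

Lemma sample_avg_le h g : (forall y, h y <= g y) -> sample_avg x h <= sample_avg x g.
Proof. by move=> hg; rewrite /sample_avg ler_wpM2l ?invr_ge0 ?ler0n // ler_sum. Qed.

Lemma sample_avg_sum (N : nat) (F : nat -> R -> R) :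
  sample_avg x (fun y => \sum_(0 <= k < N) F k y) =
  \sum_(0 <= k < N) sample_avg x (F k).
Proof. by rewrite /sample_avg exchange_big /= mulr_sumr. Qed.

Lemma sample_meanE : sample_mean x = sample_avg x id.
Proof. by []. Qed.

Lemma cvg_sample_avg (F : nat -> R -> R) h :
  (forall y, F N y @[N --> \oo] --> h y) ->
  sample_avg x (F N) @[N --> \oo] --> sample_avg x h.
Proof.
move=> Fh; rewrite /sample_avg; apply: cvgMl_tmp.
apply: cvg_big => [|i _]; [exact: add_continuous|exact: Fh].
Qed.

Lemma cvg_emp_moment_series l :
  \sum_(0 <= k < N) l ^+ k / k`!%:R * sample_avg x (fun y => y ^+ k) @[N --> \oo]
  --> emp_mgf l.
Proof.
have := @cvg_sample_avg (fun N y => \sum_(0 <= k < N) (l * y) ^+ k / k`!%:R)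
  (fun y => expR (l * y)) (fun y => @cvg_series_expR R (l * y)).
apply: cvg_trans; apply: near_eq_cvg; apply: nearW => N.
rewrite sample_avg_sum; apply: eq_bigr => k _; rewrite -sample_avgZ.
by congr sample_avg; apply/funext => y; rewrite exprMn mulrAC.
Qed.

Lemma emp_mgf_gt0 l : 0 < emp_mgf l.
Proof.
rewrite /emp_mgf /sample_avg mulr_gt0 ?invr_gt0 //.
rewrite (bigD1 (Ordinal n0)) //=; apply: ltr_pwDl; first exact: expR_gt0.
by apply: sumr_ge0 => i _; exact: expR_ge0.
Qed.

(** Separates the centering from the average of exp(l X_i), which is a mean of i.i.d. terms to which
    the probability bounds apply. *)
Lemma emp_mgf_centered l :
  n%:R^-1 * \sum_(i < n) expR (l * (x i - sample_mean x)) =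
  expR (- (l * sample_mean x)) * emp_mgf l.
Proof.
rewrite /emp_mgf -sample_avgZ; congr (_ * _); apply: eq_bigr => i _.
by rewrite -expRD; congr expR; ring.
Qed.

Lemma emp_mgf_centered_ge1 l : 1 <= expR (- (l * sample_mean x)) * emp_mgf l.
Proof.
rewrite -emp_mgf_centered.
apply: (@le_trans _ _ (sample_avg x (fun y => 1 + l * (y - sample_mean x)))).
  rewrite sample_avgD sample_avg_cst sample_avgZ.
  by rewrite (@sample_avgD id) sample_avg_cst -sample_meanE subrr mulr0 addr0.
by apply: (@sample_avg_le _ (fun y => expR (l * (y - sample_mean x)))) => y; exact: expR_ge1Dx.
Qed.

Lemma LempE l : l != 0 ->
  Lemp x l = 2 / l ^+ 2 * ln (expR (- (l * sample_mean x)) * emp_mgf l).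
Proof. by move=> l0; rewrite /Lemp (negbTE l0) emp_mgf_centered. Qed.

Lemma Lemp0 : Lemp x 0 = sample_avg x (fun y => y ^+ 2) - sample_mean x ^+ 2.
Proof.
rewrite /Lemp eqxx.
have -> : n%:R^-1 * \sum_(i < n) (x i - sample_mean x) ^+ 2 =
  sample_avg x (fun y => y ^+ 2 + (- 2 * sample_mean x * y + sample_mean x ^+ 2)).
  by congr (_ * _); apply: eq_bigr => i _; ring.
rewrite sample_avgD (@sample_avgD (fun y => _ * y)) (@sample_avgZ _ id) sample_avg_cst.
by rewrite -sample_meanE; ring.
Qed.

End sample_functions.

Lemma sum_geometric_half {R : realType} (N : nat) :
  \sum_(0 <= k < N) (2^-1 : R) ^+ k.+1 <= 1.
Proof.
suff -> : \sum_(0 <= k < N) (2^-1 : R) ^+ k.+1 = 1 - 2^-1 ^+ N.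
  by rewrite lerBlDr lerDl exprn_ge0 // invr_ge0.
elim: N => [|N IH]; first by rewrite big_geq // expr0 subrr.
by rewrite big_nat_recr //= IH exprS; field.
Qed.

(** * From deviations of the moments to deviations of L_n *)

Section moments_control.
Context {R : realType}.
Variables (P : probability R R) (s : R).
Hypotheses (hs : sub_gaussian_with P s) (s0 : 0 <= s).
Variables (n : nat) (x : 'I_n -> R).
Hypothesis n0 : (0 < n)%N.
Variables (L e : R).
Hypotheses (L0 : 0 < L) (e0 : 0 <= e).
Hypothesis dev : forall k, `|sample_avg x (fun y => y ^+ k) - moment P k|
  <= e * k`!%:R / (2 * L) ^+ k.
Implicit Types l : R.

Lemma sample_mean_le : `|sample_mean x| <= e / (2 * L).
Proof.
by have := dev 1; rewrite (moment1 hs s0) subr0 factS fact0 muln1 mulr1 expr1.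
Qed.

(** The deviation of order 0 vanishes and that of order 1 is the sample mean, so the series starts
    at order 2. The radius 2L in [dev], against |l| <= L, leaves a geometric factor 2^-k, and
    (l/L)^2 can be pulled out of every term. *)
Lemma emp_mgf_dev l : `|l| <= L ->
  `|emp_mgf x l - mgf P l - l * sample_mean x| <= (l / L) ^+ 2 * e.
Proof.
move=> lL.
pose D k := sample_avg x (fun y => y ^+ k) - moment P k.
pose u N := \sum_(0 <= k < N) l ^+ k / k`!%:R * D k.
have cu : u N @[N --> \oo] --> emp_mgf x l - mgf P l.
  have -> : u = (fun N =>
      \sum_(0 <= k < N) l ^+ k / k`!%:R * sample_avg x (fun y => y ^+ k) -
      \sum_(0 <= k < N) l ^+ k / k`!%:R * moment P k).
    by apply/funext => N; rewrite -sumrB; apply: eq_bigr => k _; rewrite -mulrBr.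
  by apply: cvgB; [exact: cvg_emp_moment_series|exact: cvg_moment_series].
have D0 : D 0 = 0.
  rewrite /D (moment0 hs) -[sample_avg _ _]/(sample_avg x (fun=> 1)).
  by rewrite sample_avg_cst // subrr.
have D1 : D 1 = sample_mean x by rewrite /D (moment1 hs s0) subr0.
have lL1 : `|l| / L <= 1 by rewrite ler_pdivrMr // mul1r.
have lL0 : 0 <= `|l| / L by rewrite divr_ge0 // ltW.
have term k : `|l ^+ k.+2 / k.+2`!%:R * D k.+2| <= (l / L) ^+ 2 * e * 2^-1 ^+ k.+1.
  have fk : 0 < (k.+2)`!%:R :> R by rewrite ltr0n fact_gt0.
  rewrite normrM normrM normfV normrX (gtr0_norm fk).
  apply: (@le_trans _ _ (`|l| ^+ k.+2 / k.+2`!%:R * (e * k.+2`!%:R / (2 * L) ^+ k.+2))).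
    by rewrite ler_wpM2l ?dev // divr_ge0 ?exprn_ge0 // ltW.
  have -> : `|l| ^+ k.+2 / k.+2`!%:R * (e * k.+2`!%:R / (2 * L) ^+ k.+2) =
      (`|l| / L) ^+ k.+2 * e * 2^-1 ^+ k.+2.
    rewrite !exprMn !exprVn; field.
    by rewrite !expf_neq0 ?gt_eqF.
  have -> : (l / L) ^+ 2 = (`|l| / L) ^+ 2.
    by rewrite !exprMn real_normK ?num_real.
  apply: ler_pM.
  - by apply: mulr_ge0 => //; apply: exprn_ge0.
  - by apply: exprn_ge0; rewrite invr_ge0.
  - by apply: ler_wpM2r => //; apply: ler_wiXn2l.
  - by apply: ler_wiXn2l => //; rewrite ?invr_ge0 // invf_le1 // ler1n.
have bnd N : `|u N.+2 - l * sample_mean x| <= (l / L) ^+ 2 * e.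
  rewrite /u !big_nat_recl // D0 D1 mulr0 add0r expr1 factS fact0 muln1 divr1 addrAC subrr add0r.
  apply: le_trans (ler_norm_sum _ _ _) _.
  apply: (@le_trans _ _ (\sum_(0 <= k < N) (l / L) ^+ 2 * e * 2^-1 ^+ k.+1)).
    by apply: ler_sum => k _; exact: term.
  rewrite -mulr_sumr; apply: ler_piMr; last exact: sum_geometric_half.
  by rewrite mulr_ge0 // sqr_ge0.
have cu2 : `|u N.+2 - l * sample_mean x| @[N --> \oo] -->
    `|emp_mgf x l - mgf P l - l * sample_mean x|.
  apply: cvg_norm; apply: cvgB; last exact: cvg_cst.
  by have := cu; rewrite -(cvg_shiftn 2); apply: cvg_trans; apply: near_eq_cvg;
    apply: nearW => N /=; rewrite addn2.
rewrite -(cvg_lim _ cu2) //; apply: limr_le; first exact: cvgP cu2.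
exact: nearW.
Qed.

(** The constant depends on [Xi] and L only; this is what makes the final bound uniform over the
    class. *)
Lemma mgf_sub1_le Xi l : s <= Xi -> `|l| <= L ->
  mgf P l - 1 <= l ^+ 2 * (Xi / 2 * expR (L ^+ 2 * Xi / 2)).
Proof.
move=> sXi lL.
have l2L : l ^+ 2 <= L ^+ 2.
  by rewrite -[l ^+ 2]real_normK ?num_real // ler_sqr ?nnegrE // ltW.
have Xi0 : 0 <= Xi by apply: le_trans sXi.
have u0 : 0 <= l ^+ 2 * s / 2 by rewrite divr_ge0 // mulr_ge0 // sqr_ge0.
have h1 := mgf_le hs l; have h2 := expR_subr1_le u0.
apply: (@le_trans _ _ (l ^+ 2 * s / 2 * expR (l ^+ 2 * s / 2))); first lra.
rewrite mulrA; apply: ler_pM; rewrite ?expR_ge0 //.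
  by rewrite mulrA ler_pM2r // ler_wpM2l // sqr_ge0.
by rewrite ler_expR ler_pM2r // ler_pM // sqr_ge0.
Qed.

Lemma emp_mgf_centered_dev Xi l : s <= Xi -> e <= 1 -> `|l| <= L ->
  `|expR (- (l * sample_mean x)) * emp_mgf x l - mgf P l| <=
  l ^+ 2 * e * (Xi / 2 * expR (L ^+ 2 * Xi / 2) + 3 / L ^+ 2).
Proof.
move=> sXi e1 lL; set G := Xi / 2 * _.
set m := sample_mean x; set M := mgf P l; set Mn := emp_mgf x l.
have l2 := sqr_ge0 l.
have iL0 : 0 < L^-1 by rewrite invr_gt0.
have iL : L^-1 * L = 1 by rewrite mulVf ?gt_eqF.
have mle : `|m| <= e / 2 * L^-1.
  by have := sample_mean_le; rewrite -/m invfM mulrA.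
have ule : `|l * m| <= e / 2.
  rewrite normrM; apply: (@le_trans _ _ (L * (e / 2 * L^-1))).
    by apply: ler_pM.
  by rewrite mulrCA mulfV ?mulr1 ?gt_eqF.
have u1 : `|l * m| <= 2^-1 by have := e0; lra.
have usq : (l * m) ^+ 2 <= l ^+ 2 * e / L ^+ 2.
  rewrite exprMn -mulrA ler_wpM2l // -[m ^+ 2]real_normK ?num_real //.
  apply: (@le_trans _ _ ((e / 2 * L^-1) ^+ 2)).
    by rewrite ler_sqr ?nnegrE // ?mulr_ge0 // ltW.
  rewrite !exprMn -exprVn ler_wpM2r ?exprn_ge0 ?(ltW iL0) //.
  have ee : e * e <= e by rewrite ler_piMr.
  have -> : e ^+ 2 * 2^-1 ^+ 2 = e * e / 4 by field.
  by have := e0; lra.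
have [E2 E1 Esq] := expRN_bounds u1.
have E0 := expR_gt0 (- (l * m)).
have r := emp_mgf_dev lL; rewrite -/m -/M -/Mn in r.
have M1 : 1 <= M := mgf_ge1 hs l s0.
have MG : M - 1 <= l ^+ 2 * G := mgf_sub1_le sXi lL.
set E := expR _ in E2 E1 Esq E0 *.
(* Each of the three terms is of order l^2 e: M - 1 is O(l^2) while E - 1 is O(e), the second is at
   most (l m)^2, and the third is controlled by [emp_mgf_dev]. The last two give 1/L^2 and 2/L^2,
   hence the constant 3/L^2. *)
have -> : E * Mn - M = (M - 1) * (E - 1) + (E * (1 + l * m) - 1) +
    E * (Mn - M - l * m) by ring.
have t1 : `|(M - 1) * (E - 1)| <= l ^+ 2 * G * e.
  rewrite normrM; apply: ler_pM => //.
    by rewrite ger0_norm // subr_ge0.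
  by lra.
have t3 : `|E * (Mn - M - l * m)| <= 2 * (l ^+ 2 / L ^+ 2 * e).
  rewrite normrM; apply: ler_pM => //; first by rewrite gtr0_norm.
  by rewrite -exprVn -exprMn.
apply: le_trans (ler_normD _ _) _; apply: le_trans (lerD (ler_normD _ _) (lexx _)) _.
apply: le_trans (lerD (lerD t1 (le_trans Esq usq)) t3) _.
rewrite le_eqVlt; apply/orP; left; apply/eqP; field.
by rewrite gt_eqF.
Qed.

(** For l nonzero the factor l^2 of [emp_mgf_centered_dev] cancels the 2/l^2 in front of the
    logarithm. At l = 0 both sides are variances, compared through the moments of orders 1 and 2. *)
Lemma Lemp_dev Xi l : sub_gaussian P -> s <= Xi -> e <= 1 -> `|l| <= L ->
  `|Lemp x l - Lpop P l| <= 2 * (Xi / 2 * expR (L ^+ 2 * Xi / 2) + 3 / L ^+ 2) * e.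
Proof.
move=> sgP sXi e1 lL.
have G0 : 0 <= Xi / 2 * expR (L ^+ 2 * Xi / 2).
  by rewrite mulr_ge0 ?expR_ge0 // divr_ge0 // (le_trans s0).
have [->|l0] := eqVneq l 0.
  rewrite Lemp0 // (Lpop0 sgP) addrAC.
  apply: le_trans (ler_normB _ _) _.
  have d2 := dev 2; have m1 := sample_mean_le.
  have m2 : `|sample_mean x ^+ 2| <= e / L ^+ 2.
    rewrite normrX; apply: (@le_trans _ _ ((e / (2 * L)) ^+ 2)).
      by rewrite ler_sqr ?nnegrE // divr_ge0 // mulr_ge0 // ltW.
    have -> : (e / (2 * L)) ^+ 2 = (e * e / 4) / L ^+ 2 by field; rewrite gt_eqF.
    rewrite ler_pM2r ?invr_gt0 ?exprn_gt0 //.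
    by have := ler_piMr e0 e1; have := e0; lra.
  have -> : 2 * (Xi / 2 * expR (L ^+ 2 * Xi / 2) + 3 / L ^+ 2) * e =
     2 * (Xi / 2 * expR (L ^+ 2 * Xi / 2)) * e + 6 * (e / L ^+ 2) by field; rewrite gt_eqF.
  have d2' : e * 2`!%:R / (2 * L) ^+ 2 = 2^-1 * (e / L ^+ 2).
    by rewrite !factS fact0 !muln1; field; rewrite gt_eqF.
  rewrite d2' in d2.
  have : 0 <= e / L ^+ 2 by rewrite divr_ge0 // sqr_ge0.
  have := mulr_ge0 G0 e0; lra.
have l2 : 0 < l ^+ 2 by rewrite exprn_even_gt0.
rewrite LempE // LpopE // -mulrBr normrM (gtr0_norm (divr_gt0 _ l2)) //.
have := emp_mgf_centered_dev sXi e1 lL.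
have := ln_subr_le (emp_mgf_centered_ge1 x n0 l) (mgf_ge1 hs l s0).
move=> /le_trans h /h {}h.
rewrite -ler_pdivlMl ?divr_gt0 //; apply: le_trans h _.
rewrite le_eqVlt; apply/orP; left; apply/eqP; field.
by rewrite l0 gt_eqF.
Qed.

End moments_control.

(** For each y, exp(ly) is monotone in l, hence at most its value at one of the endpoints. *)
Lemma emp_mgf_between {R : realType} (n : nat) (x : 'I_n -> R) (a l b : R) :
  a <= l <= b -> emp_mgf x l <= emp_mgf x a + emp_mgf x b.
Proof.
move=> /andP[al lb]; rewrite /emp_mgf -sample_avgD; apply: sample_avg_le => y.
have [y0|y0] := leP 0 y.
  by apply: ler_wpDl; rewrite ?expR_ge0 // ler_expR ler_wpM2r.
by apply: ler_wpDr; rewrite ?expR_ge0 // ler_expR ler_wnM2r // ltW.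
Qed.

(** With y = |l| between consecutive integers, interpolation costs a factor 2 and an increase 3 y a
    / 2 of the exponent, and centering costs y delta / 8. All are linear in y or bounded, and are
    absorbed by the margin y^2 delta / 4 once y >= J. *)
Lemma Lemp_tail_le {R : realType} (n : nat) (x : 'I_n -> R) (Xi s delta : R) (J : nat) (l : R) :
  (0 < n)%N -> (0 < J)%N -> 0 < delta <= s -> s <= Xi ->
  8 + 12 * Xi + delta <= 2 * J%:R * delta ->
  (forall j, (J <= j)%N -> emp_mgf x j%:R <= expR (j%:R ^+ 2 * (s - delta / 2) / 2) /\
     emp_mgf x (- j%:R) <= expR (j%:R ^+ 2 * (s - delta / 2) / 2)) ->
  `|sample_mean x| <= delta / 8 -> J%:R <= `|l| -> Lemp x l <= s.
Proof.
move=> n0 J0 /andP[d0 ds] sXi HJ hM hm Jl.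
set y := `|l| in Jl; set a := s - delta / 2 in hM.
have J1 : 1 <= J%:R :> R by rewrite ler1n.
have y1 : 1 <= y by apply: le_trans Jl.
have l0 : l != 0 by rewrite -normr_gt0; apply: lt_le_trans y1.
have l2 : 0 < l ^+ 2 by rewrite exprn_even_gt0.
have yl : y ^+ 2 = l ^+ 2 by rewrite /y real_normK ?num_real.
have y0 : 0 <= y by apply: le_trans y1.
pose j := Num.truncn y.
have /andP[jy yj] : j%:R <= y < j.+1%:R by apply: truncn_itv.
have Jj : (J <= j)%N by rewrite -ltnS -(ltr_nat R); apply: le_lt_trans yj.
have a0 : 0 <= a by rewrite /a; lra.
(* Since y >= 1, both j^2 and (j+1)^2 are at most y^2 + 3y. *)
have b1 : expR (j%:R ^+ 2 * a / 2) <= expR ((y ^+ 2 + 3 * y) * a / 2).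
  rewrite ler_expR ler_pM2r // ler_wpM2r //.
  have : j%:R ^+ 2 <= y ^+ 2 :> R by rewrite ler_sqr ?nnegrE.
  lra.
have b2 : expR (j.+1%:R ^+ 2 * a / 2) <= expR ((y ^+ 2 + 3 * y) * a / 2).
  rewrite ler_expR ler_pM2r // ler_wpM2r //.
  have : j.+1%:R ^+ 2 <= (y + 1) ^+ 2 :> R.
    by rewrite ler_sqr ?nnegrE ?ler0n ?addr_ge0 // -natr1 lerD2r.
  have -> : (y + 1) ^+ 2 = y ^+ 2 + 2 * y + 1 by ring.
  lra.
have Mle : emp_mgf x l <= 2 * expR ((y ^+ 2 + 3 * y) * a / 2).
  have [h1 h2] := hM j Jj; have [h3 h4] := hM j.+1 (leqW Jj).
  have [lp|ln] := leP 0 l.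
    have := @emp_mgf_between _ _ x j%:R l j.+1%:R.
    rewrite -(ger0_norm lp) -/y jy (ltW yj) => /(_ isT); lra.
  have := @emp_mgf_between _ _ x (- j.+1%:R) l (- j%:R).
  rewrite -(opprK l) -(ltr0_norm ln) -/y !lerN2 jy (ltW yj) => /(_ isT); lra.
rewrite LempE // -invf_div ler_pdivrMl ?divr_gt0 //.
have M0 := emp_mgf_gt0 x n0 l.
rewrite lnM ?posrE ?expR_gt0 // expRK.
have : ln (emp_mgf x l) <= 1 + (y ^+ 2 + 3 * y) * a / 2.
  apply: (@le_trans _ _ (ln (2 * expR ((y ^+ 2 + 3 * y) * a / 2)))).
    by rewrite ler_ln ?posrE // mulr_gt0 // expR_gt0.
  rewrite lnM ?posrE ?expR_gt0 // expRK lerD2r.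
  by apply: (@le_ln1Dx R 1); lra.
have : - (l * sample_mean x) <= y * (delta / 8).
  apply: le_trans (ler_norm _) _; rewrite normrN normrM -/y.
  by rewrite ler_wpM2l.
(* Eight times the inner factor is 2 y delta - 8 - 12 a - delta, which is nonnegative by [HJ] and a
   <= Xi. *)
have : y * (y * delta / 4 - 1 - 3 * a / 2 - delta / 8) >= 0.
  rewrite mulr_ge0 //.
  have : J%:R * delta <= y * delta by rewrite ler_wpM2r // ltW.
  have : a <= Xi by rewrite /a; lra.
  lra.
have -> : l ^+ 2 / 2 * s = y ^+ 2 * (a + delta / 2) / 2 by rewrite yl /a; field.
nra.
Qed.

(** The upper bound holds at every l, by comparison with L up to J and by the tail bound beyond. The
    lower bound evaluates L_n at one point of [-C0, C0] where L is within e of the optimal proxy;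
    this adds the 1 in the constant. *)
Lemma proxy_estimator_dev {R : realType} (n : nat) (x : 'I_n -> R)
    (P : probability R R) (Xi C0 delta C e : R) (J : nat) :
  (0 < n)%N -> (0 < J)%N -> 0 < C0 -> C0 <= J%:R -> C0 <= C ->
  0 < delta -> 8 + 12 * Xi + delta <= 2 * J%:R * delta ->
  sub_gaussian P -> opt_proxy P <= Xi -> tail_gap P C0 <= - delta ->
  0 < e -> e <= 1 -> e <= delta / 4 ->
  (forall k, `|sample_avg x (fun y => y ^+ k) - moment P k|
    <= e * k`!%:R / (2 * J%:R) ^+ k) ->
  (forall j, (J <= j)%N ->
     emp_mgf x j%:R <= expR (j%:R ^+ 2 * (opt_proxy P - delta / 2) / 2) /\
     emp_mgf x (- j%:R) <= expR (j%:R ^+ 2 * (opt_proxy P - delta / 2) / 2)) ->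
  `|proxy_estimator C x - opt_proxy P| <=
  (2 * (Xi / 2 * expR (J%:R ^+ 2 * Xi / 2) + 3 / J%:R ^+ 2) + 1) * e.
Proof.
move=> n0 J0 C00 C0J C0C d0 HJ sgP sXi gapP e0 e1 ed dev hM.
set K := 2 * _.
have J0R : 0 < J%:R :> R by rewrite ltr0n.
have J1 : 1 <= J%:R :> R by rewrite ler1n.
have hs := sub_gaussian_opt_proxy sgP.
have s0 := opt_proxy_ge0 sgP.
have head l : `|l| <= J%:R -> `|Lemp x l - Lpop P l| <= K * e.
  exact: (Lemp_dev hs s0 n0 J0R (ltW e0) dev sgP sXi e1).
have K0 : 0 <= K * e.
  by apply: le_trans (head 0 _); rewrite ?normr0 // ltW.
have mean : `|sample_mean x| <= delta / 8.
  have := sample_mean_le hs s0 dev; move=> /le_trans; apply.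
  rewrite ler_pdivrMr ?mulr_gt0 //.
  have : delta <= delta * J%:R by rewrite ler_peMr // ltW.
  lra.
have ub l : Lemp x l <= opt_proxy P + K * e.
  have [lJ|Jl] := leP `|l| J%:R.
    have := head l lJ; rewrite ler_norml => /andP[_].
    have := Lpop_le_opt sgP l; lra.
  apply: (@le_trans _ _ (opt_proxy P)); last by rewrite lerDl.
  apply: (Lemp_tail_le n0 J0 _ sXi HJ hM mean (ltW Jl)).
  by rewrite d0 (gap_le_opt_proxy sgP C00 d0 gapP).
have [l lC hl] := near_opt_proxy sgP C00 d0 gapP e0.
pose A := [set Lemp x l | l in [set l : R | `|l| <= C]].
have Al : A (Lemp x l) by exists l => //=; apply: le_trans C0C.
have ubA : has_ubound A by exists (opt_proxy P + K * e) => _ [z _ <-].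
have h1 : proxy_estimator C x <= opt_proxy P + K * e.
  by apply: ge_sup => [|_ [z _ <-]] //; exists (Lemp x l).
have h2 : Lemp x l <= proxy_estimator C x by apply: ub_le_sup.
have := head l (le_trans lC C0J); rewrite ler_norml => /andP[h3 _].
rewrite ler_norml; apply/andP; split; lra.
Qed.

(** * Measurability of the estimator *)

Lemma expR_le_quadratic {R : realType} (z : R) :
  expR z <= 1 + z + z ^+ 2 * expR `|z|.
Proof.
have h : expR z <= 1 + z * expR z.
  have := expR_ge1Dx (- z); rewrite expRN => h0.
  have := ler_wpM2l (expR_ge0 z) h0; rewrite divff ?expR_eq0 //; lra.
apply: le_trans h _.
have [z0|z0] := leP 0 z.
  by have := ler_wpM2l z0 (expR_subr1_le z0); rewrite (ger0_norm z0); lra.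
have h1 : 1 + z <= expR z := expR_ge1Dx z.
have h2 : 1 <= expR `|z| by rewrite -expR0 ler_expR.
have := ler_wpM2l (sqr_ge0 z) h2; nra.
Qed.

Section estimator_measurability.
Context {R : realType}.

(** Ensures that the supremum defining the estimator is not a default value. Near 0 the centered sum
    has no linear term, so the average is at most 1 + l^2 B and L_n(l) <= 2B. *)
Lemma Lemp_has_ubound (n : nat) (x : 'I_n -> R) (C : R) : (0 < n)%N ->
  has_ubound [set Lemp x l | l in [set l : R | `|l| <= C]].
Proof.
move=> n0; set m := sample_mean x.
pose W := \sum_(i < n) `|x i - m|.
pose B := n%:R^-1 * \sum_(i < n) (x i - m) ^+ 2 * expR (C * W).
have n0R : 0 <= n%:R^-1 :> R by rewrite invr_ge0.
exists (Num.max (Lemp x 0) (2 * B)) => _ [l /= lC <-].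
rewrite le_max; have [->|l0] := eqVneq l 0; first by rewrite lexx.
apply/orP; right; rewrite LempE //.
have l2 : 0 < l ^+ 2 by rewrite exprn_even_gt0.
have C0 : 0 <= C by apply: le_trans lC.
have key : expR (- (l * m)) * emp_mgf x l <= 1 + l ^+ 2 * B.
  rewrite -emp_mgf_centered -/m.
  have -> : 1 + l ^+ 2 * B = n%:R^-1 * \sum_(i < n)
      (1 + l * (x i - m) + (l * (x i - m)) ^+ 2 * expR (C * W)).
    rewrite !big_split /= -mulr_sumr sumrB !sumr_const card_ord.
    rewrite -[m *+ n]mulr_natl -[1 *+ n]mulr_natl mulr1.
    have -> : \sum_(i < n) x i = n%:R * m.
      by rewrite /m /sample_mean mulVKf // pnatr_eq0 -lt0n.
    rewrite subrr mulr0 addr0 mulrDr mulVf ?pnatr_eq0 -?lt0n //; congr (_ + _).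
    rewrite /B mulrCA; congr (_ * _); rewrite mulr_sumr; apply: eq_bigr => i _.
    by rewrite exprMn mulrA.
  apply: ler_wpM2l => //; apply: ler_sum => i _.
  apply: le_trans (expR_le_quadratic _) _; rewrite lerD2l ler_wpM2l ?sqr_ge0 //.
  rewrite ler_expR normrM ler_pM //.
  rewrite /W (bigD1 i) //= lerDl; apply: sumr_ge0 => k _; exact: normr_ge0.
have B0 : 0 <= B.
  rewrite mulr_ge0 //; apply: sumr_ge0 => i _.
  by rewrite mulr_ge0 ?expR_ge0 ?sqr_ge0.
rewrite -invf_div ler_pdivrMl ?divr_gt0 //.
have M1 := emp_mgf_centered_ge1 x n0 l; rewrite -/m in M1 *.
apply: (@le_trans _ _ (ln (1 + l ^+ 2 * B))).
  rewrite ler_ln ?posrE //; first exact: lt_le_trans M1.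
  by rewrite ltr_wpDr // mulr_ge0 // ltW.
apply: (@le_trans _ _ (l ^+ 2 * B)); last by rewrite le_eqVlt; apply/orP; left; apply/eqP; field.
by apply: le_ln1Dx; apply: (@lt_le_trans _ _ 0); rewrite ?ltrN10 // mulr_ge0 // ltW.
Qed.

Lemma Lemp_continuous (n : nat) (x : 'I_n -> R) (l : R) : (0 < n)%N -> l != 0 ->
  {for l, continuous (Lemp x)}.
Proof.
move=> n0 l0.
pose g (z : R) := 2 / z ^+ 2 * ln (expR (- (z * sample_mean x)) * emp_mgf x z).
have cg : g z @[z --> l] --> g l.
  apply: cvgM.
    apply: cvgMl_tmp; apply: cvgV; first by rewrite expf_neq0.
    by apply: cvgM; exact: cvg_id.
  apply: continuous_cvg.
    by apply: continuous_ln; rewrite mulr_gt0 ?expR_gt0 // emp_mgf_gt0.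
  apply: cvgM.
    apply: continuous_cvg; first exact: continuous_expR.
    by apply: cvgN; apply: cvgMr_tmp; exact: cvg_id.
  apply: cvgMl_tmp; apply: cvg_big => [|i _]; first exact: add_continuous.
  apply: continuous_cvg; first exact: continuous_expR.
  by apply: cvgMr_tmp; exact: cvg_id.
rewrite /prop_for /continuous_at (LempE x l0).
apply: cvg_trans cg; apply: near_eq_cvg.
near=> z; apply/esym/LempE; near: z.
by apply: (cvgr_neq0 l) => //; exact: cvg_id.
Unshelve. all: by end_near. Qed.

(* Enumerates the rationals of [-C, C], filling the other indices with 0. *)
Definition clamped_rat (C : R) (k : nat) : R :=
  if unpickle k is Some q then if `|ratr q| <= C then ratr q else 0 else 0.

Lemma clamped_rat_le (C : R) (k : nat) : 0 <= C -> `|clamped_rat C k| <= C.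
Proof.
move=> C0; rewrite /clamped_rat; case: unpickle => [q|]; last by rewrite normr0.
by case: ifPn => // _; rewrite normr0.
Qed.

Lemma clamped_ratE (C : R) (q : rat) : `|ratr q| <= C ->
  exists k, clamped_rat C k = ratr q.
Proof. by move=> qC; exists (pickle q); rewrite /clamped_rat pickleK qC. Qed.

(** A countable supremum of measurable functions is measurable. The point 0 is among the rationals;
    at other points continuity yields a nearby rational with almost the same value. *)
Lemma proxy_estimator_sups (n : nat) (x : 'I_n -> R) (C : R) :
  (0 < n)%N -> 0 < C ->
  proxy_estimator C x = sups (fun k => Lemp x (clamped_rat C k)) 0.
Proof.
move=> n0 C0; have [M MB] := Lemp_has_ubound x C n0.
pose u k := Lemp x (clamped_rat C k).
have uB k : u k <= M.
  by apply: MB; exists (clamped_rat C k) => //=; rewrite clamped_rat_le // ltW.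
have hu : has_ubound (sdrop u 0) by exists M => _ [k _ <-]; exact: uB.
apply/eqP; rewrite eq_le; apply/andP; split; last first.
  apply: ge_sup; first by exists (u 0%N), 0%N.
  move=> _ [k _ <-]; apply: ub_le_sup; first by exists M.
  by exists (clamped_rat C k) => //=; rewrite clamped_rat_le // ltW.
apply: ge_sup; first by exists (Lemp x 0), 0 => //=; rewrite normr0 ltW.
move=> _ [l /= lC <-].
have uS k : u k <= sups u 0 by apply: ub_le_sup => //; exists k.
have [->|l0] := eqVneq l 0.
  have [|k hk] := @clamped_ratE C 0; first by rewrite rmorph0 normr0 ltW.
  by have := uS k; rewrite /u hk rmorph0.
rewrite leNgt; apply/negP => hl.
have [e /= e0 he] := cvgr_gt (Lemp x l) (@Lemp_continuous n x l n0 l0) _ hl.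
(* Intersecting with ]-C, C[ keeps the interval nonempty even when |l| = C, because C > 0. *)
have [q ql] : exists q : rat, ratr q \in `]Num.max (l - e) (- C), Num.min (l + e) C[.
  apply: rat_in_itvoo; rewrite lt_min !gt_max.
  move: lC; rewrite ler_norml => /andP[h1 h2].
  by apply/andP; split; apply/andP; split; lra.
move: ql; rewrite in_itv /= gt_max lt_min => /andP[/andP[q1 q2] /andP[q3 q4]].
have [|k hk] := @clamped_ratE C q; first by rewrite ler_norml !ltW.
have := uS k; rewrite /u hk leNgt => /negP; apply; apply: he => /=.
by rewrite ltr_norml; apply/andP; split; lra.
Qed.

Lemma measurable_proxy_estimator d (T : measurableType d) (n : nat)
    (X : 'I_n -> T -> R) (C : R) : (0 < n)%N -> 0 < C ->
  (forall i, measurable_fun setT (X i)) ->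
  measurable_fun setT (fun t => proxy_estimator C (fun i => X i t)).
Proof.
move=> n0 C0 mX.
under eq_fun do rewrite proxy_estimator_sups //.
apply: measurable_fun_sups => [t _|k].
  have [M MB] := Lemp_has_ubound (fun i => X i t) C n0.
  exists M => _ [k _ <-]; apply: MB; exists (clamped_rat C k) => //=.
  by rewrite clamped_rat_le // ltW.
have mm : measurable_fun setT (fun t => sample_mean (fun i => X i t)).
  by apply: measurable_funM => //; apply: measurable_sum.
rewrite /Lemp; case: eqP => _.
  apply: measurable_funM => //; apply: measurable_sum => i.
  by apply: measurable_funX; apply: measurable_funB.
apply: measurable_funM => //; apply: measurableT_comp => //.
apply: measurable_funM => //; apply: measurable_sum => i.
by apply: measurableT_comp => //; apply: measurable_funM => //; apply: measurable_funB.
Qed.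

End estimator_measurability.

(** * Tail bounds and conclusion *)

Lemma measure_bigcup_geometric_le {d} {T : measurableType d} {R : realType}
    (Pr : probability T R) (F : nat -> set T) (A : set T) (c : R) : 0 <= c ->
  measurable A -> (forall k, measurable (F k)) -> A `<=` \bigcup_k F k ->
  (forall k, Pr (F k) <= (c * 2^-1 ^+ k.+1)%:E)%E -> (Pr A <= c%:E)%E.
Proof.
move=> c0 mA mF AF PrF.
apply: le_trans (measure_sigma_subadditive Pr mF mA AF) _.
apply: lime_le; first exact: is_cvg_nneseries.
apply: nearW => N; apply: (@le_trans _ _ (\sum_(0 <= k < N) (c * 2^-1 ^+ k.+1)%:E)%E).
  by apply: lee_sum => k _; exact: PrF.
rewrite sumEFin lee_fin -mulr_sumr.
by apply: ler_piMr => //; exact: sum_geometric_half.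
Qed.

Lemma powRN2_sqr {R : realType} (n : nat) : (n%:R `^ (- 2^-1)) ^+ 2 = n%:R^-1 :> R.
Proof. by rewrite powRN powR12_sqrt // exprVn sqr_sqrtr. Qed.

(** The factor n cancels against (n^(-1/2))^2. The scale 8J gives (8J)^(2k) = 16^k (2J)^(2k): one
    4^k pays for (2k)! <= 4^k (k!)^2, and the other leaves 4^-k <= 2^-k. *)
Lemma moment_tail_le {R : realType} (Xi J K : R) (n k : nat) : (0 < n)%N -> 0 < J -> 0 < K ->
  (k.*2)`!%:R / (8 * J) ^+ k.*2 * (2 * expR ((8 * J) ^+ 2 * Xi / 2)) /
    (n%:R * (K * n%:R `^ (- 2^-1) * k`!%:R / (2 * J) ^+ k) ^+ 2) <=
  2 * (2 * expR ((8 * J) ^+ 2 * Xi / 2)) / K ^+ 2 * 2^-1 ^+ k.+1.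
Proof.
move=> n0 J0 K0; set B := 2 * expR _.
have B0 : 0 < B by rewrite mulr_gt0 // expR_gt0.
have n0R : 0 < n%:R :> R by rewrite ltr0n.
have f0 : 0 < k`!%:R :> R by rewrite ltr0n fact_gt0.
set w := (2 * J) ^+ k.
have w0 : 0 < w by rewrite exprn_gt0 // mulr_gt0.
have -> : (8 * J) ^+ k.*2 = 4 ^+ k * 4 ^+ k * w ^+ 2.
  by rewrite -exprD addnn -exprM muln2 -exprMn; congr (_ ^+ _); ring.
have -> : n%:R * (K * n%:R `^ (- 2^-1) * k`!%:R / w) ^+ 2 =
    K ^+ 2 * k`!%:R ^+ 2 / w ^+ 2.
  rewrite !exprMn powRN2_sqr exprVn.
  by field; rewrite !gt_eqF.
have q0 : 0 < 4 ^+ k :> R by rewrite exprn_gt0.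
have qE : (4 ^+ k)^-1 <= 2^-1 ^+ k :> R.
  by rewrite exprVn lef_pV2 ?posrE ?exprn_gt0 // lerXn2r ?nnegrE // ler_nat.
have fq := @fact_double_le R k.
set q := 4 ^+ k in q0 qE fq *; set p := 2^-1 ^+ k in qE *.
have alg (F a b c f v : R) : 0 < a -> 0 < c -> 0 < f -> 0 < v ->
    F / (a * a * v ^+ 2) * b / (c ^+ 2 * f ^+ 2 / v ^+ 2) =
    F / (a * f ^+ 2) * (b / c ^+ 2) * a^-1.
  by move=> *; field; rewrite !gt_eqF.
rewrite alg //.
have -> : 2 * B / K ^+ 2 * 2^-1 ^+ k.+1 = B / K ^+ 2 * p.
  by rewrite (exprS 2^-1 k) -/p; field; rewrite gt_eqF.
have BK : 0 <= B / K ^+ 2 by rewrite divr_ge0 ?sqr_ge0 // ltW.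
apply: ler_pM.
- by rewrite mulr_ge0 // divr_ge0 // mulr_ge0 ?sqr_ge0 // ltW.
- by rewrite invr_ge0 ltW.
- by rewrite ler_piMl // ler_pdivrMr ?mulr_gt0 ?exprn_gt0 // mul1r.
- exact: qE.
Qed.

(** The quotient is exp(-(J+j)^2 delta / 4). With q = J delta >= 2, expanding the square bounds it
    by exp(-q/4) exp(-j); then exp(-q/4) <= eta/8 because eta q >= 32, and exp(-j) <= 2^-j. *)
Lemma mgf_tail_le {R : realType} (eta s delta : R) (J j : nat) : (0 < J)%N ->
  0 < eta -> 0 < delta -> 2 <= J%:R * delta -> 32 <= eta * (J%:R * delta) ->
  expR ((J + j)%:R ^+ 2 * (s - delta) / 2) /
    expR ((J + j)%:R ^+ 2 * (s - delta / 2) / 2) <= eta / 4 * 2^-1 ^+ j.+1.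
Proof.
move=> J0 eta0 d0 J2 J32; rewrite -expRB.
set y := (J + j)%:R; have J1 : 1 <= J%:R :> R by rewrite ler1n.
have -> : y ^+ 2 * (s - delta) / 2 - y ^+ 2 * (s - delta / 2) / 2 = - (y ^+ 2 * delta / 4).
  by field.
have j0 : 0 <= j%:R :> R by [].
set q := J%:R * delta in J2 J32.
have : - (y ^+ 2 * delta / 4) <= - (q / 4) + - j%:R.
  rewrite -opprD lerN2 /y natrD.
  have : q <= J%:R * q by rewrite ler_peMl // /q mulr_ge0 // ltW.
  have : j%:R * 2 <= j%:R * q by rewrite ler_wpM2l.
  have -> : (J%:R + j%:R) ^+ 2 * delta = J%:R * q + 2 * (j%:R * q) + j%:R ^+ 2 * delta.
    by rewrite /q; ring.
  have : 0 <= j%:R ^+ 2 * delta by rewrite mulr_ge0 ?sqr_ge0 // ltW.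
  lra.
move=> h; apply: (@le_trans _ _ (expR (- (q / 4)) * expR (- j%:R))).
  by rewrite -expRD ler_expR.
have -> : eta / 4 * 2^-1 ^+ j.+1 = eta / 8 * 2^-1 ^+ j by rewrite exprS; field.
apply: ler_pM; rewrite ?expR_ge0 //.
  rewrite expRN -[leRHS]invf_div lef_pV2 ?posrE ?expR_gt0 ?divr_gt0 //.
  have h1 := expR_ge1Dx (q / 4); rewrite ler_pdivrMr //.
  have : 0 < eta * expR (q / 4) by rewrite mulr_gt0 ?expR_gt0.
  have : eta * (1 + q / 4) <= eta * expR (q / 4) by rewrite ler_wpM2l // ltW.
  lra.
rewrite -mulN1r mulrC expRM_natl expRN lerXn2r ?nnegrE ?invr_ge0 ?expR_ge0 //.
rewrite lef_pV2 ?posrE ?expR_gt0 //; exact: (expR_ge1Dx 1).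
Qed.

(** The budget [eta] 2^-(k+1) at index k is split into one half for the k-th moment and one quarter
    for each of the exponential averages at J+k and -(J+k). Outside the union of these events
    [proxy_estimator_dev] applies. *)
Lemma proxy_estimator_tail {d} {T : measurableType d} {R : realType}
    (Pr : probability T R) (P : probability R R) (n : nat) (X : 'I_n -> {RV Pr >-> R})
    (Xi C0 delta C eta K : R) (J : nat) :
  iid_from P X -> sub_gaussian_class Xi P -> tail_gap P C0 <= - delta ->
  (0 < n)%N -> 0 < C0 -> 0 < delta -> 0 < eta -> C0 <= C ->
  (0 < J)%N -> C0 <= J%:R -> 8 + 12 * Xi + delta <= 2 * J%:R * delta ->
  2 <= J%:R * delta -> 32 <= eta * (J%:R * delta) ->
  0 < K -> 2 * (2 * expR ((8 * J%:R) ^+ 2 * Xi / 2)) / K ^+ 2 <= eta / 2 ->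
  K * n%:R `^ (- 2^-1) <= 1 -> K * n%:R `^ (- 2^-1) <= delta / 4 ->
  (Pr [set t | ((2 * (Xi / 2 * expR (J%:R ^+ 2 * Xi / 2) + 3 / J%:R ^+ 2) + 1) * K
      * n%:R `^ (- 2^-1) < `|proxy_estimator C (X ^~ t) - opt_proxy P|)%R]
   <= eta%:E)%E.
Proof.
move=> iidX [sgP sXi] gapP n0 C00 d0 eta0 C0C J0 C0J HJ J2 J32 K0 HK e1 ed.
have J0R : 0 < J%:R :> R by rewrite ltr0n.
set e := K * n%:R `^ (- 2^-1) in e1 ed.
have e0 : 0 < e by rewrite mulr_gt0 // powR_gt0 // ltr0n.
have hs := sub_gaussian_opt_proxy sgP.
set s := opt_proxy P in hs sXi *.
pose c k := expR ((J + k)%:R ^+ 2 * (s - delta / 2) / 2).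
pose v k := expR ((J + k)%:R ^+ 2 * (s - delta) / 2).
pose dv k := e * k`!%:R / (2 * J%:R) ^+ k.
pose A k := [set t | dv k <= `|sample_avg (X ^~ t) (fun y => y ^+ k) - moment P k|].
pose Bp k := [set t | c k <= sample_avg (X ^~ t) (fun y => expR ((J + k)%:R * y))].
pose Bm k := [set t | c k <= sample_avg (X ^~ t) (fun y => expR (- (J + k)%:R * y))].
have mexpn k : measurable_fun setT (fun y : R => y ^+ k) by apply: measurable_funX.
have mexpR l : measurable_fun setT (fun y : R => expR (l * y)).
  by apply: measurableT_comp => //; apply: measurable_funM.
have mle (a : R) (f : T -> R) : measurable_fun setT f -> measurable [set t | a <= f t].
  move=> mf; have := mf measurableT `[a, +oo[%classic (measurable_itv _).
  by rewrite setTI; congr measurable; apply/seteqP; split => t /=; rewrite in_itv /= andbT.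
have mA k : measurable (A k).
  apply: mle; apply: measurableT_comp => //; apply: measurable_funB => //.
  exact: measurable_sample_avg.
have mBp k : measurable (Bp k) by apply: mle; exact: measurable_sample_avg.
have mBm k : measurable (Bm k) by apply: mle; exact: measurable_sample_avg.
have dv0 k : 0 < dv k.
  apply: divr_gt0; last by rewrite exprn_gt0 // mulr_gt0.
  by rewrite mulr_gt0 // ltr0n fact_gt0.
have PrA k : (Pr (A k) <= (eta / 2 * 2^-1 ^+ k.+1)%:E)%E.
  have t0 : 0 < 8 * J%:R :> R by rewrite mulr_gt0.
  have mom : (\int[P]_x ((x ^+ k) ^+ 2)%:E <= ((k.*2)`!%:R / (8 * J%:R) ^+ k.*2 *
      (2 * expR ((8 * J%:R) ^+ 2 * Xi / 2)))%:E)%E.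
    apply: le_trans (even_moment_le hs k t0) _; rewrite lee_fin.
    apply: ler_wpM2l; first by rewrite divr_ge0 ?ler0n // exprn_ge0 // ltW.
    by rewrite ler_pM2l // ler_expR ler_pM2r // ler_wpM2l // sqr_ge0.
  apply: le_trans (sample_avg_chebyshev iidX n0 (dv0 k) (mexpn k) mom) _.
  rewrite lee_fin; apply: le_trans (moment_tail_le Xi k n0 J0R K0) _.
  by rewrite ler_wpM2r // exprn_ge0.
have PrB l k : `|l| = (J + k)%:R ->
    (Pr [set t | (c k <= sample_avg (X ^~ t) (fun y => expR (l * y)))%R] <=
     (eta / 4 * 2^-1 ^+ k.+1)%:E)%E.
  move=> lk.
  have l2 : l ^+ 2 = (J + k)%:R ^+ 2 by rewrite -lk real_normK ?num_real.
  have Cl : C0 <= `|l| by rewrite lk; apply: le_trans C0J _; rewrite ler_nat leq_addr.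
  have hv : (\int[P]_x (expR (l * x))%:E <= (v k)%:E)%E.
    by rewrite (mgfE hs) lee_fin /v -l2; exact: (mgf_le_gap sgP C00 d0 gapP Cl).
  apply: le_trans (sample_avg_markov iidX n0 (expR_gt0 _) (mexpR l) _ hv) _ => //.
  by rewrite lee_fin; exact: mgf_tail_le.
have PrF k : (Pr (A k `|` (Bp k `|` Bm k)) <= (eta * 2^-1 ^+ k.+1)%:E)%E.
  have h1 := PrA k.
  have h2 : (Pr (Bp k) <= (eta / 4 * 2^-1 ^+ k.+1)%:E)%E.
    by apply: PrB; rewrite ger0_norm.
  have h3 : (Pr (Bm k) <= (eta / 4 * 2^-1 ^+ k.+1)%:E)%E.
    by apply: PrB; rewrite normrN ger0_norm.
  have mB : measurable (Bp k `|` Bm k) by apply: measurableU.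
  apply: le_trans (measureU2 Pr (mA k) mB) _.
  apply: le_trans (leeD h1 (le_trans (measureU2 Pr (mBp k) (mBm k)) (leeD h2 h3))) _.
  rewrite -!EFinD lee_fin le_eqVlt; apply/orP; left; apply/eqP.
  by set p := 2^-1 ^+ k.+1; field.
apply: (@measure_bigcup_geometric_le _ _ _ _ (fun k => A k `|` (Bp k `|` Bm k))) => //.
- exact: ltW.
- have mest : measurable_fun setT (fun t => proxy_estimator C (X ^~ t)).
    by apply: measurable_proxy_estimator => //; apply: lt_le_trans C0C.
  set a := _ * n%:R `^ _.
  have mf : measurable_fun setT (fun t => `|proxy_estimator C (X ^~ t) - s|).
    by apply: measurableT_comp => //; apply: measurable_funB.
  have := mf measurableT `]a, +oo[%classic (measurable_itv _).
  by rewrite setTI; congr measurable; apply/seteqP; split => t /=; rewrite in_itv /= andbT.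
- by move=> k; do 2?apply: measurableU.
move=> t /= ht; apply: contrapT => nF.
have good k : ~ (A k `|` (Bp k `|` Bm k)) t by move=> h; apply: nF; exists k.
move: ht; apply/negP; rewrite -leNgt -mulrA -/e.
apply: (proxy_estimator_dev n0 J0 C00 C0J C0C d0 HJ sgP sXi gapP e0 e1 ed).
- move=> k; rewrite leNgt; apply/negP => h; apply: (good k); left; exact: ltW.
- move=> j Jj; rewrite -(subnKC Jj); split; rewrite leNgt; apply/negP => h;
    apply: (good (j - J)%N); right; [left|right]; exact: ltW.
Qed.

Theorem theorem3 (R : realType) (Xi C0 delta0 : R) (C : nat -> R)
  (hXi : 0 < Xi) (hC0 : 0 < C0) (hdelta0 : 0 < delta0)
  (hCpos : forall n : nat, (0 < n)%N -> 0 < C n)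
  (hC : C n @[n --> \oo] --> +oo) :
  Op_uniformly (sub_gaussian_gap_class Xi C0 (fun _ : R => - delta0))
    (fun P n x => proxy_estimator (C n) x - opt_proxy P)
    (fun n => n%:R `^ (- 2^-1)).
Proof.
move=> eta eta0.
(* J depends on [Xi], [C0], [delta0] and [eta] but not on P or n. Each summand after the 1 secures
   one of the four lower bounds on J below. *)
pose J := (Num.truncn (1 + C0 + (8 + 12 * Xi + delta0) / (2 * delta0) +
  2 / delta0 + 32 / (eta * delta0))).+1.
have pos1 : 0 < (8 + 12 * Xi + delta0) / (2 * delta0).
  by rewrite divr_gt0 ?mulr_gt0 // !addr_gt0 // mulr_gt0.
have pos2 : 0 < 2 / delta0 by rewrite divr_gt0.
have pos3 : 0 < 32 / (eta * delta0) by rewrite divr_gt0 // mulr_gt0.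
have := truncnS_gt (1 + C0 + (8 + 12 * Xi + delta0) / (2 * delta0) +
  2 / delta0 + 32 / (eta * delta0)); rewrite -/J => HJ.
have J0 : (0 < J)%N by [].
have C0J : C0 <= J%:R by lra.
have J1 : 8 + 12 * Xi + delta0 <= 2 * J%:R * delta0.
  by rewrite mulrAC [leRHS]mulrC -ler_pdivrMr ?mulr_gt0 //; lra.
have J2 : 2 <= J%:R * delta0 by rewrite -ler_pdivrMr //; lra.
have J3 : 32 <= eta * (J%:R * delta0).
  rewrite mulrCA -ler_pdivrMr ?mulr_gt0 //; lra.
pose E : R := expR ((8 * J%:R) ^+ 2 * Xi / 2).
have E0 : 0 < E by exact: expR_gt0.
(* Makes eta K >= 8E; since K >= 1 gives K^2 >= K, the total moment failure 4E / K^2 is then at most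
   eta/2. *)
pose K := 1 + 8 * E / eta.
have K1 : 1 <= K by rewrite lerDl divr_ge0 // ?mulr_ge0 // ltW.
have K0 : 0 < K by apply: lt_le_trans K1.
have HK : 2 * (2 * E) / K ^+ 2 <= eta / 2.
  have KK : K <= K ^+ 2 by rewrite expr2 ler_peMl // ltW.
  have eK : eta * K = eta + 8 * E by rewrite /K; field; rewrite gt_eqF.
  have : eta * K <= eta * K ^+ 2 by rewrite ler_wpM2l // ltW.
  by rewrite ler_pdivrMr ?exprn_gt0 // eK; lra.
have [N1 HN1] : exists N1, forall n, (N1 <= n)%N -> C0 <= C n.
  by have /cvgryPge /(_ C0) [N1 _ HN1] := hC; exists N1.
pose m := Num.min 1 (delta0 / 4).
have m0 : 0 < m by rewrite lt_min ltr01 divr_gt0.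
(* n > (K/m)^2 means K n^(-1/2) < m, which covers both smallness conditions on e; the successor also
   forces n > 0. Beyond [N1] the range of the supremum contains [-C0, C0]. *)
pose N := maxn N1 (Num.truncn ((K / m) ^+ 2)).+1.
exists ((2 * (Xi / 2 * expR (J%:R ^+ 2 * Xi / 2) + 3 / J%:R ^+ 2) + 1) * K), N.
move=> n; rewrite geq_max => /andP[nN1 nN2].
have n0 : (0 < n)%N by apply: leq_trans nN2.
have en : K * n%:R `^ (- 2^-1) <= m.
  rewrite powRN powR12_sqrt // ler_pdivrMr ?sqrtr_gt0 ?ltr0n // mulrC -ler_pdivrMr //.
  rewrite -(ler_sqr) ?nnegrE ?sqrtr_ge0 ?divr_ge0 ?(ltW K0) ?(ltW m0) // sqr_sqrtr //.
  apply: ltW; apply: lt_le_trans (truncnS_gt _) _; by rewrite ler_nat.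
move: en; rewrite le_min => /andP[en1 en2].
apply: ge_ereal_sup => p [P [[PXi gapP]]] [d] [T] [Pr] [X] [iidX ->].
exact: (proxy_estimator_tail iidX PXi (gapP C0 (lexx _)) n0 hC0 hdelta0 eta0
  (HN1 n nN1) J0 C0J J1 J2 J3 K0 HK en1 en2).
Qed.
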